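(* Let $X$ be an extremally disconnected realcompact space, and let $\mathcal{F}$ be a maximal (with respect to inclusion) singular family of positive order continuous linear functionals on $\mathrm{C}(X)$. Consider the following statements. (i) The map $\mathrm{C}(X)\ni u\mapsto (P_\varphi(u))_{\varphi\in\mathcal{F}}\in\prod_{\varphi\in\mathcal{F}}\mathrm{C}_\varphi$ is a lattice isomorphism. (ii) $\mathrm{C}(X)$ is perfect. (iii) There exists a vector lattice $\mathrm{E}$ such that $\mathrm{C}(X)$ is lattice isomorphic to $\mathrm{E}^\sim$. Then (i) implies (ii), and (ii) and (iii) are equivalent.
   Context: $\mathrm{C}(X)$ is the vector lattice of continuous real-valued functions on $X$. A realcompact space is a Tychonoff space homeomorphic to a closed subset of some product of copies of $\mathbb{R}$; $X$ is extremally disconnected if the closure of every open set is open. For a vector lattice $\mathrm{E}$, $\mathrm{E}^\sim$ is the vector lattice of order bounded linear functionals on $\mathrm{E}$, and $\mathrm{E}^\sim_{\mathrm n}$ is the sublattice of order continuous functionals ($\inf|\varphi[A]|=0$ whenever $A$ is downward directed with $\inf A=0$). $\mathrm{E}$ is perfect if the canonical map $\mathrm{E}\ni u\mapsto \Psi_u\in (\mathrm{E}^\sim_{\mathrm n})^\sim_{\mathrm n}$, $\Psi_u(\varphi)=\varphi(u)$, is a lattice isomorphism onto $(\mathrm{E}^\sim_{\mathrm n})^\sim_{\mathrm n}$. A family of positive functionals is singular if its members are pairwise disjoint: $\varphi\wedge\psi=0$ in $\mathrm{C}(X)^\sim$ for distinct $\varphi,\psi$ in the family. For $\varphi\in \mathrm{E}^\sim$,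 its null ideal is $\mathrm{N}_\varphi=\{u\in\mathrm{E}: |\varphi|(|u|)=0\}$ and its carrier is the band $\mathrm{C}_\varphi=\{u: |u|\wedge|v|=0 \text{ for all } v\in \mathrm{N}_\varphi\}$. Since $\mathrm{C}(X)$ is Dedekind complete here, each $\mathrm{C}_\varphi$ is a projection band; $P_\varphi$ is the band projection of $\mathrm{C}(X)$ onto $\mathrm{C}_\varphi$. Products of vector lattices carry coordinatewise operations. *)

(* Defs.v *)
From HB Require Import structures.
From mathcomp Require Import all_boot all_order all_algebra.
From mathcomp Require Import all_classical all_reals all_analysis.
From mathcomp Require Import lra.

Set Implicit Arguments.
Unset Strict Implicit.
Unset Printing Implicit Defensive.
Import Order.TTheory GRing.Theory Num.Theory.
Import numFieldNormedType.Exports.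

Local Open Scope classical_set_scope.
Local Open Scope ring_scope.

(* The lattice operations are fields of the mixin because Order.Lattice cannot
   be mixed into a Zmodule downstream of Num.RealDomain (Hierarchy Builder
   would need a join below it).  Num.max and Num.min also typecheck on a
   vector lattice, but are the suprema and infima only on comparable
   arguments. *)
HB.mixin Record isVectorLattice (R : realType) V
    of GRing.Lmodule R V & Num.POrderedZmodule V := {
  vjoin : V -> V -> V;
  vmeet : V -> V -> V;
  vleUx : forall u v w : V, (vjoin u v <= w) = (u <= w) && (v <= w);
  vlexI : forall u v w : V, (w <= vmeet u v) = (w <= u) && (w <= v);
  vl_leD2r : forall w u v : V, u <= v -> u + w <= v + w;
  vl_scale_ge0 : forall (a : R) (u : V), 0 <= a -> 0 <= u -> 0 <= a *: u
}.

#[short(type="vectorLatticeType")]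
HB.structure Definition VectorLattice (R : realType) :=
  { V of GRing.Lmodule R V & Num.POrderedZmodule V & isVectorLattice R V }.

Notation "u \vmax v" := (vjoin u v) (at level 48, left associativity).
Notation "u \vmin v" := (vmeet u v) (at level 48, left associativity).

Section VectorLatticeDefs.
Context {R : realType} {E : vectorLatticeType R}.

Definition vabs (u : E) : E := u \vmax (- u).

Definition vpos (u : E) : E := u \vmax 0.

Definition vneg (u : E) : E := (- u) \vmax 0.

Definition disjoint_vec (u v : E) : Prop := vabs u \vmin vabs v = 0.

End VectorLatticeDefs.

Arguments vjoin : simpl never.
Arguments vmeet : simpl never.
Arguments vabs : simpl never.
Arguments vpos : simpl never.
Arguments vneg : simpl never.

Definition lattice_isomorphism (R : realType) (E G : vectorLatticeType R)
    (f : E -> G) : Prop :=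
  [/\ linear f, {morph f : u v / u \vmax v}, {morph f : u v / u \vmin v}
    & bijective f].

Section VectorLatticeTheory.
Context {R : realType} {E : vectorLatticeType R}.
Implicit Types (u v w x y : E) (a b : R).

Lemma vleUl u v : u <= u \vmax v.
Proof. by have := lexx (u \vmax v); rewrite vleUx => /andP[]. Qed.

Lemma vleUr u v : v <= u \vmax v.
Proof. by have := lexx (u \vmax v); rewrite vleUx => /andP[]. Qed.

Lemma vleIl u v : u \vmin v <= u.
Proof. by have := lexx (u \vmin v); rewrite vlexI => /andP[]. Qed.

Lemma vleIr u v : u \vmin v <= v.
Proof. by have := lexx (u \vmin v); rewrite vlexI => /andP[]. Qed.

Lemma vjoinC u v : u \vmax v = v \vmax u.
Proof. by apply/eqP; rewrite eq_le !vleUx !vleUl !vleUr. Qed.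

Lemma vmeetC u v : u \vmin v = v \vmin u.
Proof. by apply/eqP; rewrite eq_le !vlexI !vleIl !vleIr. Qed.

Lemma vjoin_l u v : v <= u -> u \vmax v = u.
Proof. by move=> vu; apply/eqP; rewrite eq_le vleUx lexx vu vleUl. Qed.

Lemma vjoin_r u v : u <= v -> u \vmax v = v.
Proof. by rewrite vjoinC; exact: vjoin_l. Qed.

Lemma vmeet_r u v : v <= u -> u \vmin v = v.
Proof. by move=> vu; apply/eqP; rewrite eq_le vlexI lexx vu vleIr. Qed.

Lemma vmeetS u v x y : u <= x -> v <= y -> u \vmin v <= x \vmin y.
Proof.
move=> ux vy; rewrite vlexI (le_trans (vleIl _ _) ux).
by rewrite (le_trans (vleIr _ _) vy).
Qed.

Lemma vleD2r w u v : (u + w <= v + w) = (u <= v).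
Proof.
apply/idP/idP => [|/(vl_leD2r w)//].
by move=> /(vl_leD2r (- w)); rewrite !addrK.
Qed.

Lemma vleD2l w u v : (w + u <= w + v) = (u <= v).
Proof. by rewrite ![w + _]addrC vleD2r. Qed.

Lemma vleD u v x y : u <= v -> x <= y -> u + x <= v + y.
Proof.
by move=> uv xy; apply: (@le_trans _ _ (v + x)); rewrite ?vleD2r ?vleD2l.
Qed.

Lemma vsub_ge0 u v : (0 <= v - u) = (u <= v).
Proof. by rewrite -(vleD2r u 0) add0r subrK. Qed.

Lemma vleN2 u v : (- u <= - v) = (v <= u).
Proof. by rewrite -[LHS]vsub_ge0 opprK addrC vsub_ge0. Qed.

Lemma vleBlDr u v w : (u - v <= w) = (u <= w + v).
Proof. by rewrite -(vleD2r v (u - v)) subrK. Qed.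

Lemma vleBrDr u v w : (u <= v - w) = (u + w <= v).
Proof. by rewrite -(vleD2r w u) subrK. Qed.

Lemma vaddr_ge0 u v : 0 <= u -> 0 <= v -> 0 <= u + v.
Proof. by move=> u0 v0; rewrite -[0]addr0 vleD. Qed.

Lemma vle_scale a u v : 0 <= a -> u <= v -> a *: u <= a *: v.
Proof. by move=> a0 uv; rewrite -vsub_ge0 -scalerBr vl_scale_ge0 ?vsub_ge0. Qed.

Lemma vjoinDr w u v : (u \vmax v) + w = (u + w) \vmax (v + w).
Proof.
apply/eqP; rewrite eq_le [X in _ && X]vleUx !vleD2r vleUl vleUr andbT.
by rewrite -vleBrDr vleUx !vleBrDr vleUl vleUr.
Qed.

Lemma vjoinN u v : - (u \vmax v) = (- u) \vmin (- v).
Proof.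
apply/eqP; rewrite eq_le vlexI !vleN2 vleUl vleUr /=.
rewrite -[_ \vmin _]opprK vleN2 vleUx.
by rewrite -vleN2 opprK vleIl -vleN2 opprK vleIr.
Qed.

Lemma vmeetN u v : - (u \vmin v) = (- u) \vmax (- v).
Proof. by rewrite -[RHS]opprK vjoinN !opprK. Qed.

Lemma vmeetDr w u v : (u \vmin v) + w = (u + w) \vmin (v + w).
Proof. by rewrite -[LHS]opprK opprD vmeetN vjoinDr vjoinN !opprD !opprK. Qed.

Lemma vjoinE u v : u \vmax v = u + vpos (v - u).
Proof. by rewrite /vpos [u + _]addrC vjoinDr subrK add0r vjoinC. Qed.

Lemma vmeetE u v : u \vmin v = u - vpos (u - v).
Proof.
by rewrite -[LHS]opprK vmeetN vjoinE opprK opprD !opprK [- v + u]addrC.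
Qed.

Lemma vpos_ge0 u : 0 <= vpos u. Proof. exact: vleUr. Qed.

Lemma vneg_ge0 u : 0 <= vneg u. Proof. exact: vleUr. Qed.

Lemma vpos_id u : 0 <= u -> vpos u = u. Proof. exact: vjoin_l. Qed.

Lemma vneg_id u : 0 <= u -> vneg u = 0.
Proof. by move=> u0; apply/vjoin_r; rewrite -[0]oppr0 vleN2. Qed.

Lemma vnegE u : vneg u = vpos u - u.
Proof. by rewrite /vneg /vpos vjoinDr subrr add0r vjoinC. Qed.

Lemma vposBneg u : vpos u - vneg u = u.
Proof. by rewrite vnegE opprB addrCA subrr addr0. Qed.

Lemma vabs_ge u : u <= vabs u. Proof. exact: vleUl. Qed.

Lemma vabs_geN u : - u <= vabs u. Proof. exact: vleUr. Qed.

Lemma vabs_ge0 u : 0 <= vabs u.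
Proof.
have h : 0 <= 2 *: vabs u.
  by rewrite scaler_nat mulr2n -(subrr u) vleD ?vabs_ge ?vabs_geN.
have := @vl_scale_ge0 _ _ 2^-1 _ _ h.
by rewrite scalerA mulVf ?scale1r ?pnatr_eq0//; apply; rewrite invr_ge0.
Qed.

Lemma vabs_id u : 0 <= u -> vabs u = u.
Proof.
move=> u0; apply: vjoin_l; apply: (le_trans _ u0).
by rewrite -[0]oppr0 vleN2.
Qed.

Lemma vabsN u : vabs (- u) = vabs u.
Proof. by rewrite /vabs opprK vjoinC. Qed.

Lemma vabs_abs u : vabs (vabs u) = vabs u.
Proof. exact/vabs_id/vabs_ge0. Qed.

Lemma vabs_le u v : (vabs u <= v) = (- v <= u) && (u <= v).
Proof. by rewrite vleUx andbC -[_ <= u]vleN2 opprK. Qed.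

Lemma vabsD u v : vabs (u + v) <= vabs u + vabs v.
Proof.
by rewrite vleUx vleD ?vabs_ge//= opprD vleD ?vabs_geN.
Qed.

Lemma vpos_le_abs u : vpos u <= vabs u.
Proof. by rewrite vleUx vabs_ge vabs_ge0. Qed.

Lemma vneg_le_abs u : vneg u <= vabs u.
Proof. by rewrite vleUx vabs_geN vabs_ge0. Qed.

(* Riesz decomposition *)
Lemma vriesz u v w : 0 <= u -> 0 <= v -> 0 <= w -> w <= u + v ->
  [/\ 0 <= w \vmin u, w \vmin u <= u, 0 <= w - w \vmin u & w - w \vmin u <= v].
Proof.
move=> u0 v0 w0 wuv; split; first by rewrite vlexI w0.
- exact: vleIr.
- by rewrite vsub_ge0 vleIl.
- rewrite vleBlDr addrC vmeetDr vlexI wuv andbT.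
  by rewrite -[leLHS]addr0 vleD2l.
Qed.

Lemma vmeetD_le u v w : 0 <= u -> 0 <= v -> 0 <= w ->
  (u + v) \vmin w <= u \vmin w + v \vmin w.
Proof.
move=> u0 v0 w0; rewrite vmeetDr vlexI; apply/andP; split.
  rewrite [u + v \vmin w]addrC vmeetDr vlexI [v + u]addrC vleIl /=.
  by rewrite (le_trans (vleIr _ _))// -[leLHS]addr0 vleD2l.
rewrite (le_trans (vleIr _ _))// -[leLHS]addr0 vleD2l vlexI.
by rewrite v0 w0.
Qed.

End VectorLatticeTheory.

Definition order_bounded (R : realType) (E : vectorLatticeType R)
    (f : E -> R) : Prop :=
  forall a b : E, exists M : R, forall u : E, a <= u -> u <= b -> `|f u| <= M.

Definition order_dual_pred (R : realType) (E : vectorLatticeType R) :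
    {pred E -> R^o} :=
  fun f => `[< scalar f /\ order_bounded f >].
Arguments order_dual_pred {R} E.

Lemma order_dual_predP (R : realType) (E : vectorLatticeType R)
    (f : E -> R^o) :
  reflect (scalar f /\ order_bounded f) (f \in order_dual_pred E).
Proof. exact: asboolP. Qed.

Record order_dual (R : realType) (E : vectorLatticeType R) := OrderDual {
  od_fun :> E -> R^o;
  od_funP : od_fun \in order_dual_pred E
}.

HB.instance Definition _ (R : realType) (E : vectorLatticeType R) :=
  [isSub of order_dual E for @od_fun R E].
HB.instance Definition _ (R : realType) (E : vectorLatticeType R) :=
  [Choice of order_dual E by <:].

Lemma order_dual_closed (R : realType) (E : vectorLatticeType R) :
  subsemimod_closed (order_dual_pred E).
Proof.
split; [split|].
- apply/order_dual_predP; split=> [a u v|a b]; first by rewrite mulr0 addr0.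
  by exists 0 => u _ _; rewrite normr0.
- move=> f g /order_dual_predP[lf bf] /order_dual_predP[lg bg].
  apply/order_dual_predP; split=> [a u v|a b].
    by rewrite /= !addrfctE lf lg /= mulrDr addrACA.
  have [[M hM] [N hN]] := (bf a b, bg a b).
  exists (M + N) => u au ub; rewrite addrfctE.
  by rewrite (le_trans (ler_normD _ _))// lerD ?hM ?hN.
- move=> c f /order_dual_predP[lf bf].
  apply/order_dual_predP; split=> [a u v|a b].
    by rewrite /= !scalrfctE lf /= /GRing.scale/= mulrDr mulrCA.
  have [M hM] := bf a b.
  exists (`|c| * M) => u au ub; rewrite scalrfctE normrM ler_wpM2l ?hM//.
Qed.

HB.instance Definition _ (R : realType) (E : vectorLatticeType R) :=
  GRing.SubChoice_isSubLmodule.Build R (E -> R^o) (order_dual_pred E)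
    (order_dual E) (@order_dual_closed R E).

Section OrderDualOrder.
Context {R : realType} {E : vectorLatticeType R}.
Implicit Types (f g h : order_dual E) (u v w : E).

Lemma od_linear f : scalar f.
Proof. by case: f => f /= /order_dual_predP[]. Qed.

Lemma od_bounded f : order_bounded f.
Proof. by case: f => f /= /order_dual_predP[]. Qed.

Lemma odD f u v : f (u + v) = f u + f v.
Proof. by have := od_linear f 1 u v; rewrite scale1r mul1r. Qed.

Lemma od0 f : f 0 = 0.
Proof. by apply/(addrI (f 0)); rewrite -odD !addr0. Qed.

Lemma odZ f (a : R) u : f (a *: u) = a * f u.
Proof. by have := od_linear f a u 0; rewrite !addr0 od0 addr0. Qed.

Lemma odN f u : f (- u) = - f u.
Proof. by rewrite -scaleN1r odZ mulN1r. Qed.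

Lemma odB f u v : f (u - v) = f u - f v.
Proof. by rewrite odD odN. Qed.

Lemma od_addE f g u : (f + g) u = f u + g u. Proof. by []. Qed.
Lemma od_oppE f u : (- f) u = - f u. Proof. by []. Qed.
Lemma od_scaleE (a : R) f u : (a *: f) u = a * f u. Proof. by []. Qed.
Lemma od_zeroE u : (0 : order_dual E) u = 0. Proof. by []. Qed.

Lemma od_ext f g : (forall u, 0 <= u -> f u = g u) -> f = g.
Proof.
move=> fg; apply/val_inj/funext => u /=.
by rewrite -[u]vposBneg !odB !fg ?vpos_ge0 ?vneg_ge0.
Qed.

Definition od_le f g : bool := `[< forall u, 0 <= u -> f u <= g u >].

Lemma od_le_refl : reflexive od_le.
Proof. by move=> f; apply/asboolP. Qed.

Lemma od_le_anti : antisymmetric od_le.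
Proof.
move=> f g /andP[/asboolP fg /asboolP gf]; apply: od_ext => u u0.
by apply/eqP; rewrite eq_le fg ?gf.
Qed.

Lemma od_le_trans : transitive od_le.
Proof.
move=> g f h /asboolP fg /asboolP gh; apply/asboolP => u u0.
exact: le_trans (fg _ u0) (gh _ u0).
Qed.

End OrderDualOrder.

HB.instance Definition _ (R : realType) (E : vectorLatticeType R) :=
  Order.Le_isPOrder.Build ring_display (order_dual E)
    (@od_le_refl R E) (@od_le_anti R E) (@od_le_trans R E).

Section OrderDualLattice.
Context {R : realType} {E : vectorLatticeType R}.
Implicit Types (f g h : order_dual E) (u v w : E).

Lemma od_leP f g : reflect (forall u, 0 <= u -> f u <= g u) (f <= g).
Proof. exact: asboolP. Qed.

Lemma od_ge0P f : reflect (forall u, 0 <= u -> 0 <= f u) (0 <= f).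
Proof. by apply: (iffP (od_leP 0 f)) => h u /h. Qed.

Lemma od_mono f u v : 0 <= f -> u <= v -> f u <= f v.
Proof.
by move=> /od_ge0P f0 uv; rewrite -subr_ge0 -odB f0// vsub_ge0.
Qed.

Lemma od_extend (p : E -> R) :
    (forall u v, 0 <= u -> 0 <= v -> p (u + v) = p u + p v) ->
    (forall (a : R) u, 0 <= a -> 0 <= u -> p (a *: u) = a * p u) ->
    (forall u, 0 <= u -> 0 <= p u) ->
  exists f, forall u, 0 <= u -> f u = p u.
Proof.
move=> pD pZ p0.
pose q u := p (vpos u) - p (vneg u).
have qE u v : 0 <= u -> 0 <= v -> q (u - v) = p u - p v.
  move=> u0 v0; apply/eqP; rewrite subr_eq addrAC eq_sym subr_eq; apply/eqP.
  rewrite -!pD ?vpos_ge0 ?vneg_ge0//; congr p.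
  by rewrite vnegE opprB addrCA subrKC.
have q_id u : 0 <= u -> q u = p u.
  move=> u0; rewrite /q vpos_id// vneg_id// -[X in p u - p X](scale0r 0).
  by rewrite pZ// mul0r subr0.
have qD u v : q (u + v) = q u + q v.
  rewrite -[in LHS](vposBneg u) -[in LHS](vposBneg v) addrACA -opprD.
  by rewrite qE ?vaddr_ge0 ?vpos_ge0 ?vneg_ge0// !pD ?vpos_ge0 ?vneg_ge0// opprD addrACA.
have qN u : q (- u) = - q u.
  by rewrite -[in LHS](vposBneg u) opprB qE ?vpos_ge0 ?vneg_ge0// opprB.
have qZ0 (a : R) u : 0 <= a -> q (a *: u) = a * q u.
  move=> a0; rewrite -[in LHS](vposBneg u) scalerBr qE ?vl_scale_ge0 ?vpos_ge0 ?vneg_ge0//.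
  by rewrite !pZ ?vpos_ge0 ?vneg_ge0// mulrBr.
have qZ (a : R) u : q (a *: u) = a * q u.
  have [a0|a0] := leP 0 a; first exact: qZ0.
  rewrite -[in LHS](opprK a) scaleNr qN qZ0 ?mulNr ?opprK//.
  by rewrite oppr_ge0 ltW.
have qP : (q : E -> R^o) \in order_dual_pred E.
  apply/order_dual_predP; split=> [a u v|a b]; first by rewrite qD qZ.
  have qle u v : u <= v -> q u <= q v.
    move=> uv; rewrite -subr_ge0 -qN -qD q_id ?vsub_ge0// p0 ?vsub_ge0//.
  exists (`|q a| + `|q b|) => u /qle au /qle ub.
  rewrite ler_norml (le_trans _ au)/= ?(le_trans ub)//.
    by rewrite (le_trans (ler_norm _))// lerDr.
  by rewrite lerNl (le_trans (ler_norm _))// normrN lerDl.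
by exists (OrderDual qP) => u /q_id.
Qed.

(* Riesz-Kantorovich: f^+(u) = sup f([0, u]) for u >= 0. *)
Definition od_rk f u : R := sup [set f v | v in [set v : E | 0 <= v <= u]].

Lemma od_rk_ub f u v : 0 <= v -> v <= u -> f v <= od_rk f u.
Proof.
move=> v0 vu; apply: ub_le_sup; last by exists v => //=; rewrite v0.
have [M hM] := od_bounded f 0 u; exists M => _ [w /= /andP[w0 wu] <-].
exact: le_trans (ler_norm _) (hM _ w0 wu).
Qed.

Lemma od_rk_lub f u (M : R) : 0 <= u ->
  (forall v, 0 <= v -> v <= u -> f v <= M) -> od_rk f u <= M.
Proof.
move=> u0 h; apply: ge_sup; first by exists (f 0), 0 => //=; rewrite lexx u0.
by move=> _ [v /= /andP[v0 vu] <-]; exact: h.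
Qed.

Lemma od_rkD f u v : 0 <= u -> 0 <= v -> od_rk f (u + v) = od_rk f u + od_rk f v.
Proof.
move=> u0 v0; apply/eqP; rewrite eq_le; apply/andP; split.
  apply: od_rk_lub => [|w w0 wuv]; first exact: vaddr_ge0.
  have [h1 h2 h3 h4] := vriesz u0 v0 w0 wuv.
  by rewrite -[w](subrK (w \vmin u)) odD addrC lerD ?od_rk_ub.
rewrite -lerBrDr; apply: od_rk_lub => // x x0 xu.
rewrite lerBrDr addrC -lerBrDr; apply: od_rk_lub => // y y0 yv.
by rewrite lerBrDr addrC -odD od_rk_ub ?vaddr_ge0 ?vleD.
Qed.

Lemma od_rkZ f (a : R) u : 0 <= a -> 0 <= u -> od_rk f (a *: u) = a * od_rk f u.
Proof.
have rk0 w : 0 <= w -> od_rk f (0 *: w) = 0.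
  move=> w0; apply/eqP; rewrite scale0r; have := od_rkD f (lexx (0 : E)) (lexx (0 : E)).
  by rewrite addr0 => /eqP; rewrite eq_sym -subr_eq0 addrK.
have le b w : 0 < b -> 0 <= w -> od_rk f (b *: w) <= b * od_rk f w.
  move=> b0 w0; apply: od_rk_lub; first by rewrite vl_scale_ge0// ltW.
  move=> v v0 vw; have bV : 0 <= b^-1 by rewrite invr_ge0 ltW.
  rewrite -[v](scalerKV (lt0r_neq0 b0)) odZ ler_pM2l// od_rk_ub//.
    exact: vl_scale_ge0.
  by rewrite -[w](scalerK (lt0r_neq0 b0)) vle_scale.
rewrite le_eqVlt => /predU1P[<- u0|a0 u0]; first by rewrite rk0// mul0r.
apply/eqP; rewrite eq_le le//=.
rewrite -ler_pdivlMl// -[in leLHS](scalerK (lt0r_neq0 a0) u) le ?invr_gt0//.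
by rewrite vl_scale_ge0// ltW.
Qed.

Lemma od_rk_ge0 f u : 0 <= u -> 0 <= od_rk f u.
Proof. by move=> u0; rewrite -(od0 f) od_rk_ub. Qed.

Definition od_pos f : order_dual E :=
  projT1 (cid (od_extend (od_rkD f) (@od_rkZ f) (@od_rk_ge0 f))).

Lemma od_posE f u : 0 <= u -> od_pos f u = od_rk f u.
Proof. exact: (projT2 (cid (od_extend _ _ _))). Qed.

Lemma od_pos_le f g : (od_pos f <= g) = (f <= g) && (0 <= g).
Proof.
apply/od_leP/andP => [h|[/od_leP fg g0] u u0].
  split; apply/od_leP => u u0; apply: le_trans (h _ u0); rewrite od_posE//.
    exact: od_rk_ub.
  exact: od_rk_ge0.
rewrite od_posE//; apply: od_rk_lub => // v v0 vu.
exact: le_trans (fg _ v0) (od_mono g0 vu).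
Qed.

Lemma od_leD2r f g h : g <= h -> g + f <= h + f.
Proof. by move=> /od_leP gh; apply/od_leP => u u0; rewrite !od_addE lerD2r gh. Qed.

Lemma od_scale_ge0 (a : R) f : 0 <= a -> 0 <= f -> 0 <= a *: f.
Proof.
by move=> a0 /od_ge0P f0; apply/od_ge0P => u u0; rewrite od_scaleE mulr_ge0// f0.
Qed.

Lemma od_leD f g h : (g + f <= h + f) = (g <= h).
Proof.
apply/idP/idP => [|/od_leD2r//].
by move=> /(od_leD2r (- f)); rewrite !addrK.
Qed.

Lemma od_leUx f g h : (f + od_pos (g - f) <= h) = (f <= h) && (g <= h).
Proof.
rewrite -[LHS](od_leD (- f)) addrAC subrr add0r od_pos_le od_leD andbC.
by rewrite -(od_leD f 0) add0r subrK.
Qed.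

Lemma od_lexI f g h : (h <= f - od_pos (f - g)) = (h <= f) && (h <= g).
Proof.
rewrite -[LHS](od_leD (od_pos (f - g) - h)) addrCA subrr addr0 addrA subrK.
rewrite od_pos_le andbC -(od_leD h 0) add0r subrK; congr andb.
by apply/od_leP/od_leP => k u /k; rewrite !od_addE !od_oppE lerD2l lerN2.
Qed.

End OrderDualLattice.

HB.instance Definition _ (R : realType) (E : vectorLatticeType R) :=
  isVectorLattice.Build R (order_dual E)
    (@od_leUx R E) (@od_lexI R E) (@od_leD2r R E) (@od_scale_ge0 R E).

Record sublattice (R : realType) (E : vectorLatticeType R) := Sublattice {
  sl_pred :> {pred E};
  sl_submod : subsemimod_closed sl_pred;
  sl_join : {in sl_pred &, forall u v, u \vmax v \in sl_pred};
  sl_meet : {in sl_pred &, forall u v, u \vmin v \in sl_pred}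
}.

Record sub_of (R : realType) (E : vectorLatticeType R) (S : sublattice E) :=
  SubOf { sl_val : E; sl_valP : sl_val \in sl_pred S }.
Arguments SubOf {R E} S {sl_val}.

Section SublatticeStructure.
Context {R : realType} {E : vectorLatticeType R} (S : sublattice E).

HB.instance Definition _ := [isSub of sub_of S for @sl_val R E S].
HB.instance Definition _ := [Choice of sub_of S by <:].
HB.instance Definition _ :=
  GRing.SubChoice_isSubLmodule.Build R E (sl_pred S) (sub_of S) (sl_submod S).
HB.instance Definition _ :=
  Order.SubChoice_isSubPOrder.Build _ E (sl_pred S) ring_display (sub_of S).

Implicit Types x y z : sub_of S.

Definition sl_vjoin x y : sub_of S := SubOf S (sl_join (sl_valP x) (sl_valP y)).
Definition sl_vmeet x y : sub_of S := SubOf S (sl_meet (sl_valP x) (sl_valP y)).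

Lemma sl_leUx x y z : (sl_vjoin x y <= z) = (x <= z) && (y <= z).
Proof. exact: vleUx. Qed.

Lemma sl_lexI x y z : (z <= sl_vmeet x y) = (z <= x) && (z <= y).
Proof. exact: vlexI. Qed.

Lemma sl_leD2r x y z : y <= z -> y + x <= z + x.
Proof. exact: vl_leD2r. Qed.

Lemma sl_scale_ge0 (a : R) x : 0 <= a -> 0 <= x -> 0 <= a *: x.
Proof. exact: vl_scale_ge0. Qed.

HB.instance Definition _ := isVectorLattice.Build R (sub_of S)
  sl_leUx sl_lexI sl_leD2r sl_scale_ge0.

End SublatticeStructure.

Section Ideal.
Context {R : realType} {E : vectorLatticeType R} (P : {pred E}).
Hypothesis P0 : 0 \in P.
Hypothesis PD : {in P &, forall u v, u + v \in P}.
Hypothesis Psolid : forall u v, u \in P -> vabs v <= vabs u -> v \in P.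

Lemma ideal_abs u : u \in P -> vabs u \in P.
Proof. by move=> /Psolid; apply; rewrite vabs_abs. Qed.

Lemma ideal_absD u v w : u \in P -> v \in P -> vabs w <= vabs u + vabs v ->
  w \in P.
Proof.
move=> uP vP h; apply: (Psolid (PD (ideal_abs uP) (ideal_abs vP))).
by rewrite [leRHS]vabs_id// vaddr_ge0 ?vabs_ge0.
Qed.

Lemma vabs_scale_le (a : R) (u : E) (n : nat) : `|a| <= n%:R ->
  vabs (a *: u) <= n%:R *: vabs u.
Proof.
move=> an; have h b : 0 <= b -> b <= `|a| -> b *: u <= n%:R *: vabs u /\
    b *: (- u) <= n%:R *: vabs u.
  move=> b0 ba; have bn : b *: vabs u <= n%:R *: vabs u.
    by rewrite -vsub_ge0 -scalerBl vl_scale_ge0 ?vabs_ge0// subr_ge0 (le_trans ba).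
  by split; apply: le_trans bn; rewrite vle_scale ?vabs_ge ?vabs_geN.
rewrite vleUx; have [a0|a0] := leP 0 a.
  by have [h1 h2] := h a a0 (ler_norm _); rewrite h1 -scalerN h2.
have [||h1 h2] := h (- a); [by rewrite oppr_ge0 ltW|by rewrite -normrN ler_norm|].
by rewrite -scaleNr h1 andbT -[a]opprK scaleNr -scalerN h2.
Qed.

Lemma ideal_submod : subsemimod_closed P.
Proof.
split; [by split|]; move=> a u uP.
have nP n : n%:R *: vabs u \in P.
  elim: n => [|n IHn]; first by rewrite scale0r.
  by rewrite mulrSr scalerDl scale1r PD// ideal_abs.
have [n an] : exists n : nat, `|a| <= n%:R.
  by exists (Num.bound `|a|); apply/ltW/archi_boundP.
apply: Psolid (nP n) _; rewrite [leRHS]vabs_id ?vabs_scale_le//.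
by rewrite vl_scale_ge0 ?vabs_ge0.
Qed.

Lemma ideal_join : {in P &, forall u v, u \vmax v \in P}.
Proof.
move=> u v uP vP; apply: (ideal_absD uP vP); rewrite vabs_le; apply/andP; split.
  apply: le_trans (vleUl _ _).
  by rewrite -vleN2 opprK (le_trans (vabs_geN u))// -[leLHS]addr0 vleD2l vabs_ge0.
rewrite vleUx; apply/andP; split.
  by rewrite (le_trans (vabs_ge u))// -[leLHS]addr0 vleD2l vabs_ge0.
by rewrite (le_trans (vabs_ge v))// -[leLHS]add0r vleD2r vabs_ge0.
Qed.

Lemma ideal_meet : {in P &, forall u v, u \vmin v \in P}.
Proof.
have PN u : u \in P -> - u \in P by move=> /Psolid; apply; rewrite vabsN.
by move=> u v uP vP; rewrite -[_ \vmin _]opprK vmeetN PN// ideal_join// PN.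
Qed.

Definition ideal_sublattice : sublattice E :=
  Sublattice ideal_submod ideal_join ideal_meet.

End Ideal.

Section OrderContinuous.
Context {R : realType} {E : vectorLatticeType R}.
Implicit Types (A : set E) (f g : order_dual E) (u v : E).

Definition downward_directed A : Prop :=
  A !=set0 /\
  forall u v, A u -> A v -> exists w, [/\ A w, w <= u & w <= v].

Definition order_continuous f : Prop :=
  forall A, downward_directed A -> infimums A 0 ->
    inf [set `|f u| | u in A] = 0.

Lemma order_continuousP f : order_continuous f <->
  forall A, downward_directed A -> infimums A 0 ->
    forall e : R, 0 < e -> exists2 u, A u & `|f u| < e.
Proof.
split=> [h A dA A0 e e0|h A dA A0].
  have hinf : has_inf [set `|f u| | u in A].
    split; first by case: dA => -[u Au] _; exists `|f u|, u.
    by exists 0 => _ [u _ <-].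
  have [_ [u Au <-]] := inf_adherent e0 hinf.
  by rewrite h// add0r => lte; exists u.
apply/eqP; rewrite eq_le; apply/andP; split; last first.
  apply: lb_le_inf; first by case: dA => -[u Au] _; exists `|f u|, u.
  by move=> _ [u _ <-].
apply/ler_addgt0Pl => e e0; rewrite addr0.
have [u Au fu] := h _ dA A0 _ e0.
apply: le_trans (ltW fu); apply: ge_inf; last by exists u.
by exists 0 => _ [v _ <-].
Qed.

Lemma infimums_ge0 A u : infimums A 0 -> A u -> 0 <= u.
Proof. by move=> [lb _] /lb. Qed.

Lemma oc_pos f : order_continuous f -> order_continuous (vpos f).
Proof.
move=> /order_continuousP cf; apply/order_continuousP => A dA A0 e e0.
have [[x Ax] dir] := dA; have x0 := infimums_ge0 A0 Ax.
have fpE u : 0 <= u -> vpos f u = od_rk f u.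
  move=> u0; rewrite -(od_posE f u0); congr (od_fun _ u).
  apply/eqP; rewrite eq_le od_pos_le vpos_ge0 [f <= _]vleUl /=.
  by rewrite vleUx -od_pos_le lexx.
have e20 : 0 < e / 2 by rewrite divr_gt0.
have [y /andP[y0 yx] fy] : exists2 y, 0 <= y <= x & vpos f x - e / 2 < f y.
  have hsup : has_sup [set f v | v in [set v : E | 0 <= v <= x]].
    split; first by exists (f 0), 0 => //=; rewrite lexx.
    have [M hM] := od_bounded f 0 x; exists M => _ [w /= /andP[w0 wu] <-].
    exact: le_trans (ler_norm _) (hM _ w0 wu).
  have [_ [y y0x <-]] := sup_adherent e20 hsup.
  by move=> h; exists y => //; rewrite fpE.
pose B := [set y \vmin a | a in [set a | A a /\ a <= x]].
have [_ [a [Aa ax] <-] fa] : exists2 b, B b & `|f b| < e / 2.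
  apply: cf => //.
    split; first by exists (y \vmin x), x.
    move=> _ _ [a [Aa ax] <-] [b [Ab bx] <-].
    have [c [Ac ca cb]] := dir _ _ Aa Ab.
    exists (y \vmin c); split; [|exact: vmeetS|exact: vmeetS].
    by exists c => //; split=> //; exact: le_trans ca ax.
  split=> [_ [a [Aa ax] <-]|l lB].
    by rewrite vlexI y0 (infimums_ge0 A0 Aa).
  apply: A0.2 => a Aa; have [c [Ac ca cx]] := dir _ _ Aa Ax.
  apply: le_trans (lB (y \vmin c) _) (le_trans (vleIr _ _) ca).
  by exists c.
exists a => //; have a0 := infimums_ge0 A0 Aa.
rewrite ger0_norm; last by move/od_ge0P : (vpos_ge0 f); apply.
have h1 : y - y \vmin a <= x - a.
  rewrite vleBlDr addrAC vleBrDr [x + _]addrC vmeetDr vlexI vleD2l ax.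
  by rewrite [a + x]addrC vleD2r.
have h2 : f (y - y \vmin a) <= vpos f x - vpos f a.
  rewrite -odB fpE ?vsub_ge0// od_rk_ub// vsub_ge0; exact: vleIl.
rewrite odB in h2; move: fa; rewrite ltr_norml => /andP[_ fa].
by lra.
Qed.

Lemma ocN f : order_continuous f -> order_continuous (- f).
Proof.
move=> cf A dA A0; rewrite -[RHS](cf _ dA A0); congr inf.
by apply/seteqP; split=> _ [u Au <-]; exists u => //; rewrite od_oppE normrN.
Qed.

Lemma oc_posD f g : 0 <= f -> 0 <= g ->
  order_continuous f -> order_continuous g -> order_continuous (f + g).
Proof.
move=> f0 g0 /order_continuousP cf /order_continuousP cg.
apply/order_continuousP => A dA A0 e e0.
have e20 : 0 < e / 2 by rewrite divr_gt0.
have [u Au fu] := cf _ dA A0 _ e20; have [v Av gv] := cg _ dA A0 _ e20.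
have [w [Aw wu wv]] := dA.2 _ _ Au Av; exists w => //.
have fwu := le_lt_trans (le_trans (od_mono f0 wu) (ler_norm _)) fu.
have gwv := le_lt_trans (le_trans (od_mono g0 wv) (ler_norm _)) gv.
rewrite ger0_norm; last first.
  by move/od_ge0P : (vaddr_ge0 f0 g0); apply; exact: infimums_ge0 Aw.
by rewrite od_addE; lra.
Qed.

Lemma od_norm_le f u : 0 <= u -> `|f u| <= vabs f u.
Proof.
move=> u0; rewrite ler_norml lerNl; apply/andP; split.
  by rewrite -od_oppE; apply/od_leP : u0; exact: vabs_geN.
by apply/od_leP : u0; exact: vabs_ge.
Qed.

Lemma oc_le f g : 0 <= g -> order_continuous g -> vabs f <= g ->
  order_continuous f.
Proof.
move=> g0 /order_continuousP cg fg; apply/order_continuousP => A dA A0 e e0.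
have [u Au gu] := cg _ dA A0 _ e0; exists u => //; apply: le_lt_trans gu.
have u0 := infimums_ge0 A0 Au.
apply: (le_trans (od_norm_le f u0)); apply: le_trans (ler_norm _).
by move/od_leP : fg; apply.
Qed.

Lemma oc_abs f : order_continuous f -> order_continuous (vabs f).
Proof.
move=> cf; have cN : order_continuous (vneg f) := oc_pos (ocN cf).
apply: (oc_le _ (oc_posD (vpos_ge0 f) (vneg_ge0 f) (oc_pos cf) cN)).
  by rewrite vaddr_ge0 ?vpos_ge0 ?vneg_ge0.
rewrite vabs_abs vleUx; apply/andP; split.
  by rewrite (le_trans (vleUl f 0))// -[leLHS]addr0 vleD2l vneg_ge0.
by rewrite (le_trans (vleUl (- f) 0))// -[leLHS]add0r vleD2r vpos_ge0.
Qed.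

Definition oc_pred : {pred order_dual E} := fun f => `[< order_continuous f >].

Lemma oc_predP f : reflect (order_continuous f) (f \in oc_pred).
Proof. exact: asboolP. Qed.

Lemma oc_pred0 : 0 \in oc_pred.
Proof.
apply/oc_predP/order_continuousP => A [[u Au] _] A0 e e0.
by exists u => //; rewrite od_zeroE normr0.
Qed.

Lemma oc_predD : {in oc_pred &, forall f g, f + g \in oc_pred}.
Proof.
move=> f g /oc_predP/oc_abs cf /oc_predP/oc_abs cg; apply/oc_predP.
apply: (oc_le _ (oc_posD (vabs_ge0 f) (vabs_ge0 g) cf cg)).
  by rewrite vaddr_ge0 ?vabs_ge0.
exact: vabsD.
Qed.

Lemma oc_pred_solid f g : f \in oc_pred -> vabs g <= vabs f -> g \in oc_pred.
Proof.
by move=> /oc_predP/oc_abs cf gf; apply/oc_predP/(oc_le _ cf) => //; exact: vabs_ge0.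
Qed.

Definition oc_sublattice : sublattice (order_dual E) :=
  ideal_sublattice oc_pred0 oc_predD oc_pred_solid.

End OrderContinuous.

Arguments oc_sublattice {R} E.

Definition oc_dual (R : realType) (E : vectorLatticeType R) :
    vectorLatticeType R :=
  sub_of (oc_sublattice E).

Section Evaluation.
Context {R : realType} {E : vectorLatticeType R}.
Implicit Types (A : set (oc_dual E)) (f g : oc_dual E) (u v : E).

Definition oc_eval u : oc_dual E -> R^o := fun f => (val f : order_dual E) u.

Lemma oc_leP f g :
  reflect (forall u, 0 <= u -> oc_eval u f <= oc_eval u g) (f <= g).
Proof. exact: od_leP. Qed.

Lemma oc_evalB u v f : oc_eval (u - v) f = oc_eval u f - oc_eval v f.
Proof. exact: odB. Qed.

Lemma oc_eval_subproof u : oc_eval u \in order_dual_pred (oc_dual E).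
Proof.
apply/order_dual_predP; split=> [a f g //|a b].
exists (`|oc_eval (vpos u) a| + `|oc_eval (vneg u) b| +
        (`|oc_eval (vpos u) b| + `|oc_eval (vneg u) a|)) => f /oc_leP af /oc_leP fb.
rewrite -[X in oc_eval X f](vposBneg u) oc_evalB.
have := (af _ (vpos_ge0 u), fb _ (vpos_ge0 u), af _ (vneg_ge0 u), fb _ (vneg_ge0 u)).
move=> [[[]]] h1 h2 h3 h4.
have aux (p n pa pb na nb : R) : pa <= p -> p <= pb -> na <= n -> n <= nb ->
    `|p - n| <= `|pa| + `|nb| + (`|pb| + `|na|).
  have nl (x : R) : x <= `|x| /\ - `|x| <= x.
    by rewrite ler_norm lerNl -normrN ler_norm.
  move=> *; rewrite ler_norml; move: (nl pa) (nl pb) (nl na) (nl nb).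
  move=> [? ?] [? ?] [? ?] [? ?].
  have := (normr_ge0 pa, normr_ge0 pb, normr_ge0 na, normr_ge0 nb).
  by move=> [[[? ?] ?] ?]; apply/andP; split; lra.
exact: (aux _ _ _ _ _ _ h1 h2 h3 h4).
Qed.

Definition evaluation u : order_dual (oc_dual E) :=
  OrderDual (oc_eval_subproof u).

(* The infimum of a directed set of order continuous functionals is pointwise
   on the positive cone. *)
Lemma oc_inf_eval A u : downward_directed A -> infimums A 0 -> 0 <= u ->
  forall e : R, 0 < e -> exists2 f, A f & oc_eval u f < e.
Proof.
move=> [[f0 Af0] dir] A0.
pose p v := inf [set oc_eval v f | f in A].
have ge0 f v : A f -> 0 <= v -> 0 <= oc_eval v f.
  by move=> /A0.1/oc_leP h /h.
have plb f v : A f -> 0 <= v -> p v <= oc_eval v f.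
  move=> Af v0; apply: ge_inf; last by exists f.
  by exists 0 => _ [g Ag <-]; exact: ge0.
have pglb v c : (forall f, A f -> c <= oc_eval v f) -> c <= p v.
  move=> h; apply: lb_le_inf; first by exists (oc_eval v f0), f0.
  by move=> _ [g Ag <-]; exact: h.
have padh v e : 0 <= v -> 0 < e -> exists2 f, A f & oc_eval v f < p v + e.
  move=> v0 e0; have hinf : has_inf [set oc_eval v f | f in A].
    split; first by exists (oc_eval v f0), f0.
    by exists 0 => _ [g Ag <-]; exact: ge0.
  by have [_ [f Af <-]] := inf_adherent e0 hinf; exists f.
have evD v w f : oc_eval (v + w) f = oc_eval v f + oc_eval w f by exact: odD.
have evZ (a : R) w f : oc_eval (a *: w) f = a * oc_eval w f by exact: odZ.
have p0 v : 0 <= v -> 0 <= p v by move=> v0; apply: pglb => f Af; exact: ge0.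
have pD v w : 0 <= v -> 0 <= w -> p (v + w) = p v + p w.
  move=> v0 w0; apply/eqP; rewrite eq_le; apply/andP; split; last first.
    by apply: pglb => f Af; rewrite evD lerD ?plb.
  apply/ler_addgt0Pr => e e0; have e20 : 0 < e / 2 by rewrite divr_gt0.
  have [f Af fv] := padh v _ v0 e20; have [g Ag gw] := padh w _ w0 e20.
  have [h [Ah /oc_leP hf /oc_leP hg]] := dir _ _ Af Ag.
  have := plb _ _ Ah (vaddr_ge0 v0 w0); rewrite evD.
  by have := hf _ v0; have := hg _ w0; lra.
have pZ (a : R) w : 0 <= a -> 0 <= w -> p (a *: w) = a * p w.
  have le b v : 0 < b -> 0 <= v -> b * p v <= p (b *: v).
    by move=> b0 v0; apply: pglb => f Af; rewrite evZ ler_pM2l// plb.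
  rewrite le_eqVlt => /predU1P[<- w0|a0 w0].
    rewrite mul0r scale0r; apply/eqP; have := pD _ _ (lexx 0) (lexx 0).
    by rewrite addr0 => /eqP; rewrite eq_sym -subr_eq0 addrK.
  apply/eqP; rewrite eq_le le// andbT -ler_pdivrMl//.
  rewrite -[in leRHS](scalerK (lt0r_neq0 a0) w) le ?invr_gt0//.
  by rewrite vl_scale_ge0// ltW.
have [q qE] := od_extend pD pZ p0.
have q0 : 0 <= q by apply/od_ge0P => v v0; rewrite qE// p0.
have qP : q \in oc_pred.
  apply: (oc_pred_solid (valP f0)); rewrite vabs_id//.
  apply: le_trans (vabs_ge _); apply/od_leP => v v0.
  by rewrite qE//; exact: plb.
have ql : (SubOf (oc_sublattice E) qP : oc_dual E) <= 0.
  by apply: A0.2 => f Af; apply/oc_leP => v v0; rewrite /oc_eval/= qE//; exact: plb.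
move=> u0 e e0; have [f Af fu] := padh u e u0 e0; exists f => //.
apply: lt_le_trans fu _; rewrite gerDr -qE//.
by move/oc_leP : ql => /(_ _ u0).
Qed.

Lemma evaluation_oc u : evaluation u \in oc_pred.
Proof.
apply/oc_predP/order_continuousP => A dA A0 e e0.
have [f Af fu] := oc_inf_eval dA A0 (vabs_ge0 u) e0.
exists f => //; apply: le_lt_trans fu.
have f0 : 0 <= (val f : order_dual E) by exact: A0.1 Af.
rewrite ler_norml lerNl /evaluation /= /oc_eval -odN.
by rewrite !od_mono ?vabs_ge ?vabs_geN.
Qed.

Definition bidual_map u : oc_dual (oc_dual E) := SubOf (oc_sublattice (oc_dual E)) (evaluation_oc u).

End Evaluation.

Definition perfect (R : realType) (E : vectorLatticeType R) : Prop :=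
  lattice_isomorphism (@bidual_map R E).

Section Carrier.
Context {R : realType} {E : vectorLatticeType R}.
Implicit Types (u v w : E).

Lemma disjoint_vecP u v :
  disjoint_vec u v <-> vabs u \vmin vabs v <= 0.
Proof.
split=> [->//|h]; apply/eqP; rewrite eq_le h vlexI.
by rewrite !vabs_ge0.
Qed.

Variable f : order_dual E.

Definition null_ideal : set E := [set u | vabs f (vabs u) = 0].

Definition carrier_pred : {pred E} :=
  fun u => `[< forall v, null_ideal v -> disjoint_vec u v >].

Lemma carrier_predP u :
  reflect (forall v, null_ideal v -> disjoint_vec u v) (u \in carrier_pred).
Proof. exact: asboolP. Qed.

Lemma carrier0 : 0 \in carrier_pred.
Proof.
by apply/carrier_predP => v _; apply/disjoint_vecP; rewrite vabs_id// vleIl.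
Qed.

Lemma carrierD : {in carrier_pred &, forall u v, u + v \in carrier_pred}.
Proof.
move=> u v /carrier_predP uC /carrier_predP vC; apply/carrier_predP => w Nw.
apply/disjoint_vecP; apply: (le_trans (vmeetS (vabsD u v) (lexx (vabs w)))).
apply: (le_trans (vmeetD_le _ _ _)); rewrite ?vabs_ge0//.
by rewrite uC// vC// addr0.
Qed.

Lemma carrier_solid u v : u \in carrier_pred -> vabs v <= vabs u ->
  v \in carrier_pred.
Proof.
move=> /carrier_predP uC vu; apply/carrier_predP => w Nw; apply/disjoint_vecP.
by rewrite (le_trans (vmeetS vu (lexx (vabs w))))// uC.
Qed.

Definition carrier : sublattice E :=
  ideal_sublattice carrier0 carrierD carrier_solid.

End Carrier.

(* The component in B of the decomposition u = v + (u - v), with u - v disjoint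
   from B; the default value 0 is used only when there is no such v, which
   cannot happen when B is a projection band. *)
Definition band_proj (R : realType) (E : vectorLatticeType R) (B : sublattice E)
    (u : E) : sub_of B :=
  xget 0 [set v : sub_of B | forall w, w \in sl_pred B ->
                               disjoint_vec (u - val v) w].

Definition vl_prod (R : realType) (I : Type) (T : I -> vectorLatticeType R) :=
  forall i, T i.

Section Product.
Context {R : realType} {I : Type} (T : I -> vectorLatticeType R).
Local Notation P := (vl_prod T).
Implicit Types (x y z : P).

HB.instance Definition _ := gen_eqMixin P.
HB.instance Definition _ := gen_choiceMixin P.

Definition prod_zero : P := fun=> 0.
Definition prod_opp x : P := fun i => - x i.
Definition prod_add x y : P := fun i => x i + y i.
Definition prod_scale (a : R) x : P := fun i => a *: x i.

Lemma vl_prod_ext x y : (forall i, x i = y i) -> x = y.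
Proof. exact: functional_extensionality_dep. Qed.

Lemma prod_addA : associative prod_add.
Proof. by move=> x y z; apply: vl_prod_ext => i; exact: addrA. Qed.

Lemma prod_addC : commutative prod_add.
Proof. by move=> x y; apply: vl_prod_ext => i; exact: addrC. Qed.

Lemma prod_add0 : left_id prod_zero prod_add.
Proof. by move=> x; apply: vl_prod_ext => i; exact: add0r. Qed.

Lemma prod_addN : left_inverse prod_zero prod_opp prod_add.
Proof. by move=> x; apply: vl_prod_ext => i; exact: addNr. Qed.

HB.instance Definition _ :=
  GRing.isZmodule.Build P prod_addA prod_addC prod_add0 prod_addN.

Lemma prod_scaleA (a b : R) x : prod_scale a (prod_scale b x) = prod_scale (a * b) x.
Proof. by apply: vl_prod_ext => i; exact: scalerA. Qed.

Lemma prod_scale1 : left_id 1 prod_scale.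
Proof. by move=> x; apply: vl_prod_ext => i; exact: scale1r. Qed.

Lemma prod_scaleDr : right_distributive prod_scale +%R.
Proof. by move=> a x y; apply: vl_prod_ext => i; exact: scalerDr. Qed.

Lemma prod_scaleDl x : {morph prod_scale^~ x : a b / a + b}.
Proof. by move=> a b; apply: vl_prod_ext => i; exact: scalerDl. Qed.

HB.instance Definition _ := GRing.Zmodule_isLmodule.Build R P
  prod_scaleA prod_scale1 prod_scaleDr prod_scaleDl.

Definition prod_le x y : bool := `[< forall i, x i <= y i >].

Lemma prod_le_refl : reflexive prod_le.
Proof. by move=> x; apply/asboolP. Qed.

Lemma prod_le_anti : antisymmetric prod_le.
Proof.
move=> x y /andP[/asboolP xy /asboolP yx]; apply: vl_prod_ext => i.
by apply/eqP; rewrite eq_le xy yx.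
Qed.

Lemma prod_le_trans : transitive prod_le.
Proof.
move=> y x z /asboolP xy /asboolP yz; apply/asboolP => i.
exact: le_trans (xy i) (yz i).
Qed.

HB.instance Definition _ :=
  Order.Le_isPOrder.Build ring_display P prod_le_refl prod_le_anti prod_le_trans.

Definition prod_join x y : P := fun i => x i \vmax y i.
Definition prod_meet x y : P := fun i => x i \vmin y i.

Lemma prod_leP x y : reflect (forall i, x i <= y i) (x <= y).
Proof. exact: asboolP. Qed.

Lemma prod_leUx x y z : (prod_join x y <= z) = (x <= z) && (y <= z).
Proof.
apply/prod_leP/andP => [h|[/prod_leP xz /prod_leP yz] i].
  by split; apply/prod_leP => i; have := h i; rewrite vleUx => /andP[].
by rewrite vleUx xz yz.
Qed.

Lemma prod_lexI x y z : (z <= prod_meet x y) = (z <= x) && (z <= y).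
Proof.
apply/prod_leP/andP => [h|[/prod_leP zx /prod_leP zy] i].
  by split; apply/prod_leP => i; have := h i; rewrite vlexI => /andP[].
by rewrite vlexI zx zy.
Qed.

Lemma prod_leD2r x y z : y <= z -> y + x <= z + x.
Proof. by move=> /prod_leP yz; apply/prod_leP => i; exact: vl_leD2r (x i) _ _ (yz i). Qed.

Lemma prod_scale_ge0 (a : R) x : 0 <= a -> 0 <= x -> 0 <= a *: x.
Proof.
by move=> a0 /prod_leP x0; apply/prod_leP => i; exact: vl_scale_ge0 (x0 i).
Qed.

HB.instance Definition _ := isVectorLattice.Build R P
  prod_leUx prod_lexI prod_leD2r prod_scale_ge0.

End Product.

Section ContinuousFunctions.
Context (R : realType) (X : topologicalType).

Definition cont_fun := continuousType X R.

HB.instance Definition _ := Choice.on cont_fun.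

Definition cont_pred : {pred X -> R^o} := fun f => `[< continuous (f : X -> R) >].

Lemma cont_predP (f : X -> R) :
  reflect (continuous f) ((f : X -> R^o) \in cont_pred).
Proof. exact: asboolP. Qed.

Definition cont_val (f : cont_fun) : X -> R^o := f.

Definition cont_sub (f : X -> R^o) (fP : f \in cont_pred) : cont_fun :=
  mkcts (elimT (cont_predP f) fP).

Lemma cont_rect (K : cont_fun -> Type) :
  (forall f fP, K (@cont_sub f fP)) -> forall f, K f.
Proof.
move=> h f; have fP : cont_val f \in cont_pred by apply/cont_predP/cts_fun.
by have -> : f = cont_sub fP; [exact/continuousEP|exact: h].
Qed.

Lemma cont_subK f fP : cont_val (@cont_sub f fP) = f. Proof. by []. Qed.

HB.instance Definition _ :=
  @isSub.Build (X -> R^o) cont_pred cont_fun cont_val cont_sub cont_rect cont_subK.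

Lemma cont_closed : subsemimod_closed cont_pred.
Proof.
split; [split|].
- by apply/cont_predP; exact: cst_continuous.
- move=> f g /cont_predP cf /cont_predP cg; apply/cont_predP => x.
  by apply: (@cvgD R R^o); [exact: cf|exact: cg].
- move=> a f /cont_predP cf; apply/cont_predP => x.
  by apply: (@cvgZ R R^o); [exact: cvg_cst|exact: cf].
Qed.

HB.instance Definition _ :=
  GRing.SubChoice_isSubLmodule.Build R (X -> R^o) cont_pred cont_fun cont_closed.

Implicit Types f g h : cont_fun.

Definition cont_le f g : bool := `[< forall x, f x <= g x >].

Lemma cont_le_refl : reflexive cont_le.
Proof. by move=> f; apply/asboolP. Qed.

Lemma cont_le_anti : antisymmetric cont_le.
Proof.
move=> f g /andP[/asboolP fg /asboolP gf]; apply/continuousEP => x.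
by apply/eqP; rewrite eq_le fg gf.
Qed.

Lemma cont_le_trans : transitive cont_le.
Proof.
move=> g f h /asboolP fg /asboolP gh; apply/asboolP => x.
exact: le_trans (fg x) (gh x).
Qed.

HB.instance Definition _ := Order.Le_isPOrder.Build ring_display cont_fun
  cont_le_refl cont_le_anti cont_le_trans.

Lemma cont_leP f g : reflect (forall x, f x <= g x) (f <= g).
Proof. exact: asboolP. Qed.

Lemma cont_max_subproof f g : continuous (fun x => Num.max (f x) (g x)).
Proof. by move=> x; apply: continuous_max; exact: cts_fun. Qed.

Lemma cont_min_subproof f g : continuous (fun x => Num.min (f x) (g x)).
Proof. by move=> x; apply: continuous_min; exact: cts_fun. Qed.

Definition cont_max f g : cont_fun := mkcts (@cont_max_subproof f g).
Definition cont_min f g : cont_fun := mkcts (@cont_min_subproof f g).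

Lemma cont_leUx f g h : (cont_max f g <= h) = (f <= h) && (g <= h).
Proof.
apply/cont_leP/andP => [k|[/cont_leP fh /cont_leP gh] x].
  by split; apply/cont_leP => x; have := k x; rewrite ge_max => /andP[].
by rewrite ge_max fh gh.
Qed.

Lemma cont_lexI f g h : (h <= cont_min f g) = (h <= f) && (h <= g).
Proof.
apply/cont_leP/andP => [k|[/cont_leP hf /cont_leP hg] x].
  by split; apply/cont_leP => x; have := k x; rewrite le_min => /andP[].
by rewrite le_min hf hg.
Qed.

Lemma cont_leD2r f g h : g <= h -> g + f <= h + f.
Proof. by move=> /cont_leP gh; apply/cont_leP => x; rewrite lerD2r gh. Qed.

Lemma cont_scale_ge0 (a : R) f : 0 <= a -> 0 <= f -> 0 <= a *: f.
Proof.
by move=> a0 /cont_leP f0; apply/cont_leP => x; exact: mulr_ge0 (f0 x).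
Qed.

HB.instance Definition _ := isVectorLattice.Build R cont_fun
  cont_leUx cont_lexI cont_leD2r cont_scale_ge0.

End ContinuousFunctions.

Arguments cont_fun : clear implicits.

Definition homeomorphic (X Y : topologicalType) : Prop :=
  exists (f : X -> Y) (g : Y -> X),
    [/\ continuous f, continuous g, cancel f g & cancel g f].

Definition tychonoff_space (X : topologicalType) : Prop :=
  hausdorff_space X /\ completely_regular_space X.

Definition realcompact (R : realType) (X : topologicalType) : Prop :=
  tychonoff_space X /\
  exists (I : Type) (A : set (prod_topology (fun _ : I => R))),
    closed A /\ homeomorphic X (set_type A).

Definition extremally_disconnected (X : topologicalType) : Prop :=
  forall U : set X, open U -> open (closure U).

Definition singular_family (R : realType) (E : vectorLatticeType R)
    (F : set (order_dual E)) : Prop :=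
  (forall f, F f -> 0 <= f) /\
  (forall f g, F f -> F g -> f <> g -> f \vmin g = 0).

Definition maximal_singular_oc_family (R : realType) (E : vectorLatticeType R)
    (F : set (order_dual E)) : Prop :=
  [/\ singular_family F, F `<=` order_continuous (E := E) &
    forall G : set (order_dual E), singular_family G ->
      G `<=` order_continuous (E := E) -> F `<=` G -> G = F].

(* Main.v *)
(* Nakano's criterion: a vector lattice is perfect as soon as its order
   continuous functionals separate points and every upward directed set of
   positive elements on which they are all bounded has a supremum ([levi]).
   An order dual E^~ has both properties, through the evaluations at points of
   E and pointwise suprema, so (iii) implies (ii).

   On C(X), every positive functional f satisfies f((u - n)^+) = 0 for some n
   depending on u (otherwise it would be infinite on a locally finite series),
   so that f-dominated series of functionals converge as soon as their values
   at the constant 1 do.  Hence every functional on C(X)^~_n is order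
   continuous, and (ii) gives (iii) with E = C(X)^~_n.  It also follows that a
   set bounded on all order continuous functionals is bounded f-almost
   everywhere by a constant M_f; under (i), the element with components
   P_f(M_f 1) is then an upper bound of the set, and extremal disconnectedness
   provides the supremum. *)
Require Import Defs.
From mathcomp Require Import all_boot all_order all_algebra.
From mathcomp Require Import all_classical all_reals all_analysis.
From mathcomp Require Import lra.

Set Implicit Arguments.
Unset Strict Implicit.
Unset Printing Implicit Defensive.
Import Order.TTheory GRing.Theory Num.Theory.
Import numFieldNormedType.Exports.

Local Open Scope classical_set_scope.
Local Open Scope ring_scope.

(** * Directed suprema and the two hypotheses of Nakano's criterion *)

Definition upward_directed (R : realType) (V : vectorLatticeType R)
    (D : set V) : Prop :=
  D !=set0 /\ forall u v, D u -> D v -> exists w, [/\ D w, u <= w & v <= w].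

(** Full Dedekind completeness reduces to this form: close a bounded set under finite joins, cut it
    off below at one of its elements, and translate. *)
Definition dedekind (R : realType) (V : vectorLatticeType R) : Prop :=
  forall (D : set V) b, upward_directed D -> (forall u, D u -> 0 <= u) ->
    ubound D b -> exists s, supremums D s.

Definition levi (R : realType) (V : vectorLatticeType R) : Prop :=
  forall D : set V, upward_directed D -> (forall u, D u -> 0 <= u) ->
    (forall f : order_dual V, 0 <= f -> order_continuous f ->
       exists M : R, forall u, D u -> f u <= M) ->
    exists s, supremums D s.

Definition separating (R : realType) (V : vectorLatticeType R) : Prop :=
  forall u : V, 0 <= u -> u <> 0 ->
    exists f : order_dual V, [/\ 0 <= f, order_continuous f & f u <> 0].

(** * Approximation, components and directed suprema of functionals *)

Section Functionals.
Context {R : realType} {V : vectorLatticeType R}.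
Implicit Types (f g h : order_dual V) (u v w x : V) (D : set V).

Lemma od_ge0 f u : 0 <= f -> 0 <= u -> 0 <= f u.
Proof. by move=> /od_ge0P; apply. Qed.

(** Both [vpos f] and [od_pos f] are least upper bounds of [f] and [0], so the abstract positive
    part is given by the Riesz-Kantorovich formula. *)
Lemma od_vposE f u : 0 <= u -> vpos f u = od_rk f u.
Proof.
move=> u0; rewrite -(od_posE f u0); congr (od_fun _ u).
apply/eqP; rewrite eq_le od_pos_le vpos_ge0 [f <= _]vleUl /=.
by rewrite vleUx -od_pos_le lexx.
Qed.

Lemma od_rk_approx f u (e : R) : 0 <= u -> 0 < e ->
  exists v, [/\ 0 <= v, v <= u & od_rk f u - e < f v].
Proof.
move=> u0 e0.
have hsup : has_sup [set f v | v in [set v : V | 0 <= v <= u]].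
  split; first by exists (f 0), 0 => //=; rewrite lexx.
  have [M hM] := od_bounded f 0 u; exists M => _ [w /= /andP[w0 wu] <-].
  exact: le_trans (ler_norm _) (hM _ w0 wu).
have [_ [y /= /andP[y0 yu] <-] h] := sup_adherent e0 hsup.
by exists y; split.
Qed.

Lemma vpos_meet_vneg u : vpos u \vmin vneg u = 0.
Proof. by rewrite vmeetE vposBneg subrr. Qed.

(** Since [f \vmin g = f - vpos (f - g)], disjointness says that [f u] is the supremum of
    [f v - g v] over [0 <= v <= u]; a near-maximizer [v] works. *)
Lemma od_meet0_split f g u (e : R) : f \vmin g = 0 -> 0 <= u -> 0 < e ->
  exists v, [/\ 0 <= v, v <= u & f (u - v) + g v < e].
Proof.
move=> fg0 u0 e0.
have E : od_rk (f - g) u = f u.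
  have := congr1 (fun h : order_dual V => h u) fg0.
  rewrite vmeetE -(od_vposE _ u0) => h.
  have : f u - vpos (f - g) u = 0 by exact: h.
  by move/eqP; rewrite subr_eq0 => /eqP.
have [v [v0 vu]] := od_rk_approx (f - g) u0 e0.
rewrite E => h; exists v; split=> //.
have {}h : f u - e < f v - g v by exact: h.
by rewrite odB; lra.
Qed.

(** Order continuity is applied to the set of all [s - u] with [u] in [D], which is directed
    downward to [0]. *)
Lemma oc_sup_approx f D s (e : R) : 0 <= f -> order_continuous f ->
  upward_directed D -> supremums D s -> 0 < e -> exists2 u, D u & f s - e < f u.
Proof.
move=> f0 /order_continuousP cf [[u0 Du0] dir] [ub lub] e0.
have [||_ [u Du <-] h] := cf [set s - u | u in D] _ _ _ e0.
- split; first by exists (s - u0), u0.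
  move=> _ _ [u Du <-] [v Dv <-]; have [w [Dw uw vw]] := dir _ _ Du Dv.
  by exists (s - w); rewrite !vleD2l !vleN2; split => //; exists w.
- split; first by move=> _ [u Du <-]; rewrite vsub_ge0; exact: ub.
  move=> l lD; have : s <= s - l.
    apply: lub => u Du; have : l <= s - u by apply: lD; exists u.
    by rewrite !vleBrDr addrC.
  by rewrite -[X in X <= _]addr0 vleD2l -vleN2 opprK oppr0.
exists u => //; move: h; rewrite odB ltr_norml => /andP[_]; lra.
Qed.

Lemma vmeet_ge0 u v : 0 <= u -> 0 <= v -> 0 <= u \vmin v.
Proof. by rewrite vlexI => -> ->. Qed.

(* psi v = sup_n f (v /\ n w): the part of f carried by the band of w. *)
Lemma od_component f w : 0 <= f -> 0 <= w ->
  exists g, [/\ 0 <= g, g <= f, g w = f w &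
    forall v, 0 <= v -> v \vmin w = 0 -> g v = 0].
Proof.
move=> f0 w0.
pose p v := sup [set f (v \vmin (n%:R *: w)) | n in [set: nat]].
have nw n : 0 <= n%:R *: w by rewrite vl_scale_ge0.
have pub v n : 0 <= v -> f (v \vmin (n%:R *: w)) <= p v.
  move=> v0; apply: ub_le_sup; last by exists n.
  by exists (f v) => _ [k _ <-]; apply: od_mono => //; exact: vleIl.
have plub v c : (forall n, f (v \vmin (n%:R *: w)) <= c) -> p v <= c.
  move=> h; apply: ge_sup; first by exists (f (v \vmin (0%:R *: w))), 0%N.
  by move=> _ [n _ <-].
have p0 v : 0 <= v -> 0 <= p v.
  by move=> v0; apply: le_trans (pub v 0%N v0); rewrite od_ge0// vmeet_ge0.
have pf v : p v <= f v by apply: (plub) => n; rewrite od_mono// vleIl.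
have pD u v : 0 <= u -> 0 <= v -> p (u + v) = p u + p v.
  move=> u0 v0; apply/eqP; rewrite eq_le; apply/andP; split.
    apply: (plub) => n; apply: le_trans (lerD (pub u n u0) (pub v n v0)).
    by rewrite -odD od_mono// vmeetD_le.
  rewrite -lerBrDr; apply: (plub) => m; rewrite lerBrDr addrC -lerBrDr.
  apply: (plub) => n; rewrite lerBrDr addrC -odD.
  apply: le_trans (pub _ (m + n)%N (vaddr_ge0 u0 v0)).
  apply: od_mono => //; rewrite vlexI vleD ?vleIl//= natrD scalerDl.
  by rewrite vleD ?vleIr.
have p00 : p 0 = 0.
  by apply/eqP; have := pD 0 0 (lexx _) (lexx _); rewrite addr0 => /eqP; rewrite eq_sym -subr_eq0 addrK.
have pZle (a : R) v : 0 < a -> 0 <= v -> a * p v <= p (a *: v).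
  move=> a0 v0; rewrite -ler_pdivlMl//; apply: (plub) => n; rewrite ler_pdivlMl//.
  (* Scaling by [a] turns the cap [n w] into [(a n) w], which an integer multiple [k w] absorbs. *)
  rewrite -odZ; have [k nk] : exists k : nat, a * n%:R <= k%:R.
    by exists (Num.bound (a * n%:R)); apply/ltW/archi_boundP; rewrite mulr_ge0// ltW.
  have av0 : 0 <= a *: v by apply: vl_scale_ge0 => //; exact: ltW.
  apply: le_trans (pub (a *: v) k av0); apply: od_mono => //.
  rewrite vlexI vle_scale ?vleIl ?(ltW a0)//=.
  apply: le_trans (vle_scale (ltW a0) (vleIr _ _)) _.
  by rewrite scalerA -vsub_ge0 -scalerBl vl_scale_ge0// subr_ge0.
have pZ (a : R) v : 0 <= a -> 0 <= v -> p (a *: v) = a * p v.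
  rewrite le_eqVlt => /predU1P[<- v0|a0 v0]; first by rewrite scale0r p00 mul0r.
  apply/eqP; rewrite eq_le pZle// andbT -ler_pdivrMl//.
  rewrite -[in leRHS](scalerK (lt0r_neq0 a0) v) pZle ?invr_gt0//.
  by rewrite vl_scale_ge0// ltW.
have [g gE] := od_extend pD pZ p0; exists g; split.
- by apply/od_ge0P => v v0; rewrite gE// p0.
- by apply/od_leP => v v0; rewrite gE.
- rewrite gE//; apply/eqP; rewrite eq_le pf /=; apply: le_trans (pub w 1%N w0).
  by rewrite scale1r od_mono// vlexI lexx.
- move=> v v0 vw; rewrite gE//; apply/eqP; rewrite eq_le p0// andbT.
  apply: (plub) => n; suff -> : v \vmin (n%:R *: w) = 0 by rewrite od0.
  apply/eqP; rewrite eq_le vmeet_ge0// andbT.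
  elim: n => [|n IH]; first by rewrite scale0r vleIr.
  rewrite mulrSr scalerDl scale1r vmeetC.
  apply: le_trans (vmeetD_le _ _ _) _ => //.
  by rewrite [w \vmin v]vmeetC vw addr0 vmeetC.
Qed.

(** The pointwise supremum on the positive cone is superadditive because [D] is directed, hence it
    extends to a functional. *)
Lemma od_directed_sup (D : set (order_dual V)) :
  upward_directed D -> (forall f, D f -> 0 <= f) ->
  (forall u, 0 <= u -> exists M : R, forall f, D f -> f u <= M) ->
  exists s, [/\ supremums D s,
    (forall u (e : R), 0 <= u -> 0 < e -> exists2 f, D f & s u - e < f u) &
    ((forall f, D f -> order_continuous f) -> order_continuous s)].
Proof.
move=> [[f0 Df0] dir] D0 Db.
pose p v := sup [set (f : order_dual V) v | f in D].
have hs v : 0 <= v -> has_sup [set (f : order_dual V) v | f in D].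
  move=> v0; split; first by exists (f0 v), f0.
  by have [M hM] := Db v v0; exists M => _ [f Df <-]; exact: hM.
have pub v f : 0 <= v -> D f -> f v <= p v.
  by move=> v0 Df; apply: ub_le_sup; [exact: (hs v v0).2|exists f].
have plub v c : (forall f, D f -> f v <= c) -> p v <= c.
  move=> h; apply: ge_sup; first by exists (f0 v), f0.
  by move=> _ [f Df <-]; exact: h.
have padh v (e : R) : 0 <= v -> 0 < e -> exists2 f, D f & p v - e < f v.
  move=> v0 e0; have [_ [f Df <-] h] := sup_adherent e0 (hs v v0).
  by exists f.
have p0 v : 0 <= v -> 0 <= p v.
  by move=> v0; apply: le_trans (pub v f0 v0 Df0); exact: od_ge0 (D0 _ Df0) v0.
have pD u v : 0 <= u -> 0 <= v -> p (u + v) = p u + p v.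
  move=> u0 v0; apply/eqP; rewrite eq_le; apply/andP; split.
    by apply: (plub) => f Df; rewrite odD lerD// pub.
  rewrite -lerBrDr; apply: (plub) => f Df; rewrite lerBrDr addrC -lerBrDr.
  apply: (plub) => g Dg; rewrite lerBrDr addrC.
  have [h [Dh /od_leP fh /od_leP gh]] := dir _ _ Df Dg.
  by apply: le_trans (pub _ _ (vaddr_ge0 u0 v0) Dh); rewrite odD lerD ?fh ?gh.
have p00 : p 0 = 0.
  by apply/eqP; have := pD 0 0 (lexx _) (lexx _); rewrite addr0 => /eqP; rewrite eq_sym -subr_eq0 addrK.
have pZle (a : R) v : 0 < a -> 0 <= v -> a * p v <= p (a *: v).
  move=> a0 v0; rewrite -ler_pdivlMl//; apply: (plub) => f Df; rewrite ler_pdivlMl//.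
  by rewrite -odZ pub// vl_scale_ge0// ltW.
have pZ (a : R) v : 0 <= a -> 0 <= v -> p (a *: v) = a * p v.
  rewrite le_eqVlt => /predU1P[<- v0|a0 v0]; first by rewrite scale0r p00 mul0r.
  apply/eqP; rewrite eq_le pZle// andbT -ler_pdivrMl//.
  rewrite -[in leRHS](scalerK (lt0r_neq0 a0) v) pZle ?invr_gt0//.
  by rewrite vl_scale_ge0// ltW.
have [s sE] := od_extend pD pZ p0.
have sadh u (e : R) : 0 <= u -> 0 < e -> exists2 f, D f & s u - e < f u.
  by move=> u0 e0; rewrite sE//; exact: padh.
have sub f : D f -> f <= s by move=> Df; apply/od_leP => u u0; rewrite sE// pub.
have s0 : 0 <= s by apply: le_trans (sub _ Df0); exact: D0.
exists s; split => //.
  split; first by move=> f; exact: sub.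
  move=> t Dt; apply/od_leP => u u0; rewrite sE//; apply: (plub) => f Df.
  by move/od_leP : (Dt f Df); exact.
move=> Dc; apply/order_continuousP => A dA A0 e e0.
have [[a Aa] _] := dA; have e20 : 0 < e / 2 by rewrite divr_gt0.
(* As [s - f] is positive, its smallness at [a] persists at every [c] of [A] below [a]; there only
   [f c] remains to be made small. *)
have [f Df fa] := sadh a _ (infimums_ge0 A0 Aa) e20.
have [b Ab fb] := (order_continuousP f).1 (Dc f Df) A dA A0 _ e20.
have [c [Ac ca cb]] := dA.2 _ _ Aa Ab; exists c => //.
have c0 := infimums_ge0 A0 Ac; rewrite ger0_norm ?od_ge0//.
have h1 := od_mono (D0 _ Df) cb; have h2 := le_lt_trans (ler_norm _) fb.
have : f (a - c) <= s (a - c).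
  by move/od_leP : (sub _ Df); apply; rewrite vsub_ge0.
rewrite !odB; lra.
Qed.

End Functionals.

(** * Strict positivity and absolute continuity in Dedekind complete lattices *)

Section Dedekind.
Context {R : realType} {V : vectorLatticeType R} (dV : dedekind V).
Implicit Types (f g h : order_dual V) (u v w x : V).

(** For positive [f] and [b] this means that [b] lies in the carrier of [f]. *)
Definition strictly_positive f b : Prop :=
  forall w, 0 <= w -> w <= b -> f w = 0 -> w = 0.

Lemma vjoin_le_add u v : 0 <= u -> 0 <= v -> u \vmax v <= u + v.
Proof.
move=> u0 v0; rewrite vleUx -[X in X <= _]addr0 vleD2l v0 /=.
by rewrite -[X in X <= _]add0r vleD2r.
Qed.

(** Take for [a] the supremum of the null vectors of [f] below [v]: it is null by order continuity,
    and a null vector below [v - a] could be added to it. *)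
Lemma oc_strict_split f v : 0 <= f -> order_continuous f -> 0 <= v ->
  exists a b, [/\ 0 <= a, 0 <= b, a + b = v, f a = 0 & strictly_positive f b].
Proof.
move=> f0 cf v0.
pose D := [set w | [/\ 0 <= w, w <= v & f w = 0]].
have uD : upward_directed D.
  split; first by exists 0; split => //; exact: od0.
  move=> x y [x0 xv fx] [y0 yv fy]; exists (x \vmax y).
  rewrite vleUl vleUr; split => //; split.
  - exact: le_trans (vleUl _ _).
  - by rewrite vleUx xv.
  - apply/eqP; rewrite eq_le od_ge0 ?andbT ?(le_trans x0 (vleUl _ _))//.
    by rewrite (le_trans (od_mono f0 (vjoin_le_add x0 y0)))// odD fx fy addr0.
have [|v' [] //|s sD] := dV (b := v) uD; first by move=> w [].
have sv : s <= v by apply: sD.2 => w [].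
have s0 : 0 <= s by apply: sD.1; split => //; exact: od0.
have fs : f s = 0.
  apply/eqP; rewrite eq_le od_ge0// andbT; apply/ler_addgt0Pr => e e0.
  have [w [_ _ fw]] := oc_sup_approx f0 cf uD sD e0; rewrite fw; lra.
exists s, (v - s); split => //; first by rewrite vsub_ge0.
  by rewrite addrC subrK.
move=> w w0 wv fw; apply/eqP; rewrite eq_le w0 andbT.
have : s + w <= s.
  apply: sD.1; split; first exact: vaddr_ge0.
    by rewrite addrC -vleBrDr.
  by rewrite odD fs fw addr0.
by rewrite -[X in _ <= X]addr0 vleD2l.
Qed.

Lemma half_expr_lt (e : R) : 0 < e -> exists n, 2^-1 ^+ n < e.
Proof.
move=> e0; have [n hn] : exists n : nat, e^-1 < n%:R.
  by exists (Num.bound e^-1); apply/archi_boundP; rewrite invr_ge0 ltW.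
exists n; rewrite exprVn -[e]invrK ltf_pV2 ?posrE ?invr_gt0 ?exprn_gt0//.
by apply: lt_trans hn _; rewrite -natrX ltr_nat ltn_expl.
Qed.

(* Borel-Cantelli: if [f (a n) < 2^-n], then [inf_n sup_(k >= n) a k] is a null
   vector of [f], hence zero. *)
Lemma oc_absolutely_continuous f g b (e : R) :
  0 <= f -> order_continuous f -> 0 <= g -> order_continuous g ->
  strictly_positive f b -> 0 < e ->
  exists2 d : R, 0 < d & forall a, 0 <= a -> a <= b -> f a < d -> g a < e.
Proof.
move=> f0 cf g0 /order_continuousP cg fb e0.
apply: contrapT => hn.
have {}hn n : exists a, [/\ 0 <= a, a <= b, f a < 2^-1 ^+ n & e <= g a].
  apply: contrapT => h; apply: hn; exists (2^-1 ^+ n).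
    by rewrite exprn_gt0// invr_gt0.
  move=> a a0 ab fa; rewrite ltNge; apply/negP => ea.
  by apply: h; exists a.
have {hn} [a ha] := choice hn.
(* [J n m] is the join of [a n], ..., [a (n + m)]; its supremum over [m] is [s n] below. *)
pose J n := fix J m := if m is m'.+1 then J m' \vmax a (n + m)%N else a n.
have Jb n m : J n m <= b.
  elim: m => [|m IH] /=; first by have [] := ha n.
  by rewrite vleUx IH; have [_ ->] := ha (n + m.+1)%N.
have aJ n m : a (n + m)%N <= J n m.
  by case: m => [|m]; [rewrite addn0 /= lexx|rewrite /= vleUr].
have JS n m : J n m <= J n m.+1 by rewrite /= vleUl.
have Jmono n m m' : (m <= m')%N -> J n m <= J n m'.
  move=> /subnK <-; elim: (m' - m)%N => [//|k IH].
  by rewrite addSn (le_trans IH).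
have J0 n m : 0 <= J n m.
  by apply: le_trans (aJ n m); have [] := ha (n + m)%N.
(* The right-hand side is the geometric sum of [2^-k] for [n <= k <= n + m]. *)
have fJ n m : f (J n m) <= 2 * 2^-1 ^+ n - 2^-1 ^+ (n + m).
  elim: m => [|m IH] /=.
    by have [_ _ /ltW h _] := ha n; rewrite addn0; lra.
  have [a0 _ /ltW h _] := ha (n + m.+1)%N.
  apply: le_trans (od_mono f0 (vjoin_le_add (J0 n m) a0)) _.
  rewrite odD; have : (2^-1 : R) ^+ (n + m) = 2 * 2^-1 ^+ (n + m.+1).
    by rewrite addnS exprS mulrA divff ?mul1r// pnatr_eq0.
  lra.
have uJ n : upward_directed (range (J n)).
  split; first by exists (J n 0%N), 0%N.
  move=> _ _ [m _ <-] [k _ <-]; exists (J n (maxn m k)).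
  by split; [exists (maxn m k)| |]; rewrite ?Jmono ?leq_maxl ?leq_maxr.
have hs n : exists s, supremums (range (J n)) s.
  apply: (dV (b := b)) => //.
    by move=> _ [m _ <-].
  by move=> _ [m _ <-].
have {hs} [s hs] := choice hs.
have sb n : s n <= b by apply: (hs n).2 => _ [m _ <-].
have as_ n m : a (n + m)%N <= s n.
  by apply: le_trans (aJ n m) _; apply: (hs n).1; exists m.
have fs n : f (s n) <= 2 * 2^-1 ^+ n.
  apply/ler_addgt0Pr => d d0.
  have [_ [m _ <-]] := oc_sup_approx f0 cf (uJ n) (hs n) d0.
  have := fJ n m; have : 0 <= (2^-1 : R) ^+ (n + m) by rewrite exprn_ge0 ?invr_ge0.
  lra.
have sS n : s n.+1 <= s n.
  apply: (hs n.+1).2 => _ [m _ <-].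
  elim: m => [|m IH] /=; first by rewrite -addn1.
  by rewrite vleUx IH addSnnS as_.
have smono n m : (n <= m)%N -> s m <= s n.
  move=> /subnK <-; elim: (m - n)%N => [//|k IH].
  by rewrite addSn (le_trans _ IH).
have [||_ [n _ <-] gs] := cg (range s) _ _ e e0.
- split; first by exists (s 0%N), 0%N.
  move=> _ _ [m _ <-] [k _ <-]; exists (s (maxn m k)).
  by split; [exists (maxn m k)| |]; rewrite ?smono ?leq_maxl ?leq_maxr.
- split=> [_ [n _ <-]|l ls].
    by apply: le_trans (J0 n 0%N) _; apply: (hs n).1; exists 0%N.
  (* The positive part of a lower bound lies in [[0, b]] and below every [s n], so it is null for
     [f] and vanishes by strict positivity. *)
  suff l0 : vpos l = 0 by apply: le_trans (vleUl l 0) _; rewrite -/(vpos l) l0.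
  have ps n : vpos l <= s n.
    rewrite vleUx; apply/andP; split; first by apply: ls; exists n.
    by apply: le_trans (J0 n 0%N) _; apply: (hs n).1; exists 0%N.
  apply: fb; [exact: vpos_ge0|exact: le_trans (ps 0%N) (sb _)|].
  apply/eqP; rewrite eq_le od_ge0 ?vpos_ge0// andbT.
  apply/ler_addgt0Pr => d d0; rewrite add0r.
  have [n hn] : exists n, (2^-1 : R) ^+ n < d / 2.
    by apply: half_expr_lt; rewrite divr_gt0.
  by have := od_mono f0 (ps n); have := fs n; lra.
have [_ _ _ ea] := ha n.
have := od_mono g0 (as_ n 0%N); rewrite addn0.
by move: gs; rewrite ltr_norml => /andP[_]; lra.
Qed.

(** Disjointness splits [b] into [b - v] and [v] with [f (b - v)] and [g v] small; absolute
    continuity then makes [g (b - v)] small too. *)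
Lemma oc_disjoint_null f g b :
  0 <= f -> order_continuous f -> 0 <= g -> order_continuous g ->
  f \vmin g = 0 -> 0 <= b -> strictly_positive f b -> g b = 0.
Proof.
move=> f0 cf g0 cg fg b0 fb.
apply/eqP; rewrite eq_le od_ge0// andbT; apply/ler_addgt0Pr => e e0.
have e20 : 0 < e / 2 by rewrite divr_gt0.
have [d d0 hd] := oc_absolutely_continuous f0 cf g0 cg fb e20.
have m0 : 0 < Num.min d (e / 2) by rewrite lt_min d0.
have [v [v0 vb]] := od_meet0_split fg b0 m0.
have bv : 0 <= b - v by rewrite vsub_ge0.
have bvb : b - v <= b by rewrite vleBlDr -[X in X <= _]addr0 vleD2l.
have := od_ge0 f0 bv; have := od_ge0 g0 v0.
rewrite lt_min => gv fbv /andP[h1 h2].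
have fd : f (b - v) < d by lra.
by have := hd _ bv bvb fd; rewrite odB; lra.
Qed.

End Dedekind.

(** * Density of the evaluations in the order continuous bidual *)

Section NakanoDensity.
Context {R : realType} {V : vectorLatticeType R}.
Local Notation G := (oc_dual V).
Implicit Types (u v w x : V) (p q : G).

Lemma oc_dual_sup (D : set G) : upward_directed D ->
  (forall p, D p -> 0 <= p) ->
  (forall u, 0 <= u -> exists M : R, forall p, D p -> oc_eval u p <= M) ->
  exists s, supremums D s.
Proof.
move=> [[p0 Dp0] dir] D0 Db.
have [|||s [ss _ sc]] := @od_directed_sup R V [set val p | p in D].
- split; first by exists (val p0), p0.
  move=> _ _ [p Dp <-] [q Dq <-]; have [r [Dr pr qr]] := dir _ _ Dp Dq.
  by exists (val r); split => //; exists r.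
- by move=> _ [p Dp <-]; exact: D0.
- move=> u u0; have [M hM] := Db u u0; exists M => _ [p Dp <-]; exact: hM.
have sP : s \in sl_pred (oc_sublattice V).
  apply/oc_predP/sc => _ [p _ <-]; apply/oc_predP; exact: valP.
exists (SubOf _ sP); split.
  by move=> p Dp; apply: ss.1; exists p.
by move=> q qD; apply: ss.2 => _ [p Dp <-]; exact: (qD p Dp).
Qed.

Lemma dedekind_oc_dual : dedekind G.
Proof.
move=> D b uD D0 Db; apply: oc_dual_sup => // u u0.
by exists (oc_eval u b) => p Dp; move/oc_leP : (Db p Dp); apply.
Qed.

Lemma evaluation_ge0 u : 0 <= u -> 0 <= evaluation u.
Proof. by move=> u0; apply/od_ge0P => p /oc_leP /(_ u u0). Qed.

Lemma evaluation_order_continuous u : order_continuous (evaluation u).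
Proof. by have := evaluation_oc u => /oc_predP. Qed.

(** The component [g] of [p] on [vpos u] satisfies [g <= p] and kills [vneg u], so
    [p (vpos u) = g u] is one of the values in the Riesz-Kantorovich supremum. *)
Lemma evaluation_vpos u : evaluation (vpos u) = vpos (evaluation u).
Proof.
apply/eqP; rewrite eq_le; apply/andP; split; last first.
  rewrite vleUx evaluation_ge0 ?vpos_ge0// andbT.
  by apply/od_leP => p p0; apply: od_mono p0 _; exact: vleUl.
apply/od_leP => p p0.
have [g [g0 gp gu gd]] := od_component (f := val p) p0 (vpos_ge0 u).
have gP : g \in sl_pred (oc_sublattice V).
  by apply: oc_pred_solid (valP p) _; rewrite vabs_id// (le_trans gp)// vabs_ge.
have -> : evaluation (vpos u) p = evaluation u (SubOf _ gP).
  rewrite /evaluation /= /oc_eval /= -gu -[in RHS](vposBneg u) odB.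
  by rewrite (gd (vneg u)) ?subr0 ?vneg_ge0// vmeetC vpos_meet_vneg.
rewrite od_vposE//; apply: od_rk_ub => //.
Qed.

Hypothesis dV : dedekind V.

(** Compare [L] with the evaluation at a small [y]. Some [b] in the dual is positive at [y] and null
    for the negative part of the difference [Th]; the part [u] of [y] carried by [b] then evaluates
    below [L]. *)
Lemma evaluation_dense (L : order_dual G) : 0 <= L -> order_continuous L ->
  L <> 0 -> exists u, [/\ 0 <= u, u <> 0 & evaluation u <= L].
Proof.
move=> L0 cL Ln0.
have dG := dedekind_oc_dual.
have [p0 p00 Lp0] : exists2 p : G, 0 <= p & L p <> 0.
  apply: contrapT => h; apply: Ln0; apply: od_ext => p p0.
  by rewrite od_zeroE; apply: contrapT => h'; apply: h; exists p.
have [a [p [_ pge0 apE La Lp]]] := oc_strict_split dG L0 cL p00.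
have Lp1 : L p <> 0 by move=> h; apply: Lp0; rewrite -apE odD La h addr0.
have [x x0 px] : exists2 x, 0 <= x & 0 < oc_eval x p.
  apply: contrapT => h; apply: Lp1; suff -> : p = 0 by exact: od0.
  apply/val_inj/od_ext => x x0; apply/eqP; rewrite eq_le.
  move/oc_leP : (pge0) => /(_ x x0) px0; rewrite [X in _ && X]px0 andbT.
  by rewrite leNgt; apply/negP => h'; apply: h; exists x.
have cx := evaluation_order_continuous x; have ex0 := evaluation_ge0 x0.
have p20 : 0 < oc_eval x p / 2 by rewrite divr_gt0.
have [d d0 hd] := oc_absolutely_continuous dG L0 cL ex0 cx Lp p20.
(* The factor [e] is small enough that [L] is below [d] on any part of [p] where [L] is at most the
   evaluation at [e *: x]. *)
have [e e0 ed] : exists2 e : R, 0 < e & e * oc_eval x p < d.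
  exists (d / (2 * oc_eval x p)); first by rewrite divr_gt0// mulr_gt0.
  rewrite invfM mulrA mulfVK ?gt_eqF//; lra.
pose y := e *: x; have y0 : 0 <= y by rewrite vl_scale_ge0// ltW.
pose Th := L - evaluation y.
have oT : order_continuous Th.
  apply/oc_predP; rewrite /Th oc_predD//; first exact/oc_predP.
  by apply/oc_predP/ocN/evaluation_order_continuous.
have cTn : order_continuous (vneg Th) by exact/oc_pos/ocN.
have cTp : order_continuous (vpos Th) by exact/oc_pos.
(* A Hahn decomposition of [p] for [Th]: the negative part vanishes on [b], the positive part on
   [c]. Absolute continuity shows that [c] takes less than half of [p x], so [b x] is positive. *)
have [b [c [b0 c0 bcE Tb Tc]]] := oc_strict_split dG (vneg_ge0 Th) cTn pge0.
have Tcp : vpos Th c = 0.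
  apply: (oc_disjoint_null dG (vneg_ge0 Th) cTn (vpos_ge0 Th) cTp _ c0 Tc).
  by rewrite vmeetC; exact: vpos_meet_vneg.
have LTE q : L q = vpos Th q - vneg Th q + oc_eval y q.
  have -> : vpos Th q - vneg Th q = Th q by rewrite -[in RHS](vposBneg Th).
  by rewrite /Th; have : Th q = L q - oc_eval y q by []; rewrite /Th; lra.
have yxE q : oc_eval y q = e * oc_eval x q by exact: odZ.
have cp : c <= p by rewrite -bcE -[X in X <= _]add0r vleD2r.
have cx2 : oc_eval x c < oc_eval x p / 2.
  apply: (hd c c0 cp); apply: le_lt_trans ed.
  rewrite LTE Tcp yxE sub0r; have := od_ge0 (vneg_ge0 Th) c0.
  have : oc_eval x c <= oc_eval x p by move/oc_leP : cp; apply.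
  by move=> h h'; rewrite addrC lerBlDr ler_wpDr// ler_wpM2l// ltW.
have bx : 0 < oc_eval x b.
  have : oc_eval x p = oc_eval x b + oc_eval x c by rewrite -bcE.
  lra.
have bge0 : 0 <= (val b : order_dual V) by exact: b0.
have cb : order_continuous (val b) by apply/oc_predP; exact: valP.
have [w [u [w0 u0 wuE bw bu]]] := oc_strict_split dV bge0 cb y0.
exists u; split => //.
  move=> u00; move: bx; rewrite -(pmulr_rgt0 _ e0) -yxE /oc_eval -wuE u00.
  by rewrite addr0 bw ltxx.
apply/od_leP => q q0.
(* On [q1] the evaluation at [y] is at most [L]; [q2] is disjoint from [b] and hence vanishes at
   [u]. *)
have [q1 [q2 [q10 q20 qE Tq1 Tq2]]] := oc_strict_split dG (vneg_ge0 Th) cTn q0.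
have q2u : oc_eval u q2 = 0.
  have h0 : 0 <= (val q2 : order_dual V) by exact: q20.
  have hc : order_continuous (val q2) by apply/oc_predP; exact: valP.
  apply: (oc_disjoint_null dV bge0 cb h0 hc _ u0 bu).
  suff : b \vmin q2 = 0 by move/(congr1 val).
  apply: Tq2; rewrite ?vmeet_ge0 ?vleIr//.
  apply/eqP; rewrite eq_le od_ge0 ?vneg_ge0 ?vmeet_ge0// andbT -Tb.
  by rewrite od_mono ?vneg_ge0 ?vleIl.
have Lq1 : oc_eval y q1 <= L q1.
  by rewrite LTE Tq1 subr0 ler_wpDl// od_ge0// vpos_ge0.
have uy : u <= y by rewrite -wuE -[X in X <= _]add0r vleD2r.
have -> : evaluation u q = oc_eval u q1 + oc_eval u q2 by rewrite -qE.
rewrite q2u addr0; apply: (@le_trans _ _ (oc_eval y q1)).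
  by apply: od_mono => //; exact: q10.
by apply: le_trans Lq1 _; rewrite -qE odD ler_wpDr// od_ge0.
Qed.

End NakanoDensity.

(** * Nakano's criterion for perfectness *)

Section NakanoPerfect.
Context {R : realType} {V : vectorLatticeType R}.
Local Notation G := (oc_dual V).
Implicit Types (u v w : V) (L : order_dual G).

Lemma levi_dedekind : levi V -> dedekind V.
Proof.
move=> lV D b uD D0 Db; apply: lV => // f f0 _.
by exists (f b) => u Du; apply: od_mono => //; exact: Db.
Qed.

Lemma evaluationB u v : evaluation (u - v) = evaluation u - evaluation v.
Proof. by apply/val_inj/funext => p; exact: odB. Qed.

Lemma evaluationD u v : evaluation (u + v) = evaluation u + evaluation v.
Proof. by apply/val_inj/funext => p; exact: odD. Qed.

Lemma evaluation_vjoin u v :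
  evaluation (u \vmax v) = evaluation u \vmax evaluation v.
Proof. by rewrite !vjoinE evaluationD evaluation_vpos evaluationB. Qed.

Lemma evaluation_vmeet u v :
  evaluation (u \vmin v) = evaluation u \vmin evaluation v.
Proof. by rewrite !vmeetE evaluationB evaluation_vpos evaluationB. Qed.

Hypotheses (sV : separating V) (lV : levi V).

Lemma evaluation_inj : injective (@evaluation R V).
Proof.
have pos0 w : evaluation w = 0 -> vpos w = 0.
  move=> w0; apply: contrapT => /(sV (vpos_ge0 w)) [f [f0 cf]]; apply.
  have fP : f \in sl_pred (oc_sublattice V) by exact/oc_predP.
  have : evaluation (vpos w) (SubOf _ fP) = 0.
    by rewrite evaluation_vpos w0 vpos_id.
  by [].
move=> u v uv; apply/eqP; rewrite -subr_eq0 -[_ - _]vposBneg; apply/eqP.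
rewrite pos0 ?evaluationB ?uv ?subrr// sub0r.
have -> : vneg (u - v) = vpos (v - u) by rewrite /vneg opprB.
by rewrite pos0 ?oppr0// evaluationB uv subrr.
Qed.

(** The preimage is the supremum [s] of all positive [u] whose evaluation is at most [L]; it exists
    because [L] itself bounds this set on each functional. If a gap remained, density would put a
    nonzero [u] into it, and [s + u] would belong to the set. *)
Lemma evaluation_onto_pos L : 0 <= L -> order_continuous L ->
  exists u, evaluation u = L.
Proof.
move=> L0 cL; pose D := [set u | 0 <= u /\ evaluation u <= L].
have uD : upward_directed D.
  split.
    exists 0; split => //; apply: le_trans L0.
    by apply/od_leP => p _; rewrite /evaluation /= /oc_eval od0.
  move=> u v [u0 uL] [v0 vL]; exists (u \vmax v).
  rewrite vleUl vleUr; split => //; split; first exact: le_trans u0 (vleUl _ _).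
  by rewrite evaluation_vjoin vleUx uL.
have [|f f0 cf|s sD] := lV uD; first by move=> u [].
  have fP : f \in sl_pred (oc_sublattice V) by exact/oc_predP.
  exists (L (SubOf _ fP)) => u [u0 /od_leP uL].
  by apply: (uL (SubOf _ fP)).
have s0 : 0 <= s.
  by have [u Du] := uD.1; apply: le_trans Du.1 (sD.1 _ Du).
have sL : evaluation s <= L.
  apply/od_leP => p p0; apply/ler_addgt0Pr => e e0.
  have pge0 : 0 <= (val p : order_dual V) by exact: p0.
  have cp : order_continuous (val p) by apply/oc_predP; exact: valP.
  have [u [u0 /od_leP uL] h] := oc_sup_approx pge0 cp uD sD e0.
  have := uL p p0; rewrite -[evaluation u p]/((val p : order_dual V) u).
  rewrite -[evaluation s p]/((val p : order_dual V) s); lra.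
exists s; apply: contrapT => sLn.
have L'0 : 0 <= L - evaluation s by rewrite vsub_ge0.
have cL' : order_continuous (L - evaluation s).
  by apply/oc_predP; rewrite oc_predD//; apply/oc_predP => //; exact/ocN/evaluation_order_continuous.
have [|u [u0 un0 uL]] := evaluation_dense (levi_dedekind lV) L'0 cL'.
  by move/eqP; rewrite subr_eq0 => /eqP/esym.
apply: un0; apply/eqP; rewrite eq_le u0 andbT.
have : s + u <= s.
  apply: sD.1; split; first exact: vaddr_ge0.
  by rewrite evaluationD addrC -vleBrDr.
by rewrite -[X in _ <= X]addr0 vleD2l.
Qed.

Theorem nakano_perfect : perfect V.
Proof.
split.
- move=> a u v; apply/val_inj/val_inj/funext => p; exact: od_linear.
- move=> u v; apply: val_inj; exact: evaluation_vjoin.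
- move=> u v; apply: val_inj; exact: evaluation_vmeet.
have [|g gK] := @choice _ _ (fun (M : oc_dual G) (u : V) => bidual_map u = M).
  move=> M; have cM : order_continuous (val M) by apply/oc_predP; exact: valP.
  have [u uM] := evaluation_onto_pos (vpos_ge0 (val M)) (oc_pos cM).
  have [v vM] := evaluation_onto_pos (vneg_ge0 (val M)) (oc_pos (ocN cM)).
  exists (u - v); apply: val_inj.
  by rewrite /= evaluationB uM vM vposBneg.
exists g => [u|M]; last exact: gK.
by apply: evaluation_inj; have := gK (bidual_map u) => /(congr1 val).
Qed.

End NakanoPerfect.

(** * Order properties of lattice isomorphisms *)

Section LatticeIsomorphism.
Context {R : realType} {V W : vectorLatticeType R} (T : V -> W).
Hypothesis iT : lattice_isomorphism T.
Implicit Types u v : V.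

Lemma lattice_iso_inj : injective T.
Proof. by case: iT => _ _ _ /bij_inj. Qed.

Lemma lattice_iso_onto w : exists u, T u = w.
Proof. by case: iT => _ _ _ [g _ gK]; exists (g w). Qed.

Lemma lattice_iso_le u v : (T u <= T v) = (u <= v).
Proof.
have [_ TU _ _] := iT; apply/idP/idP => [h|h].
  rewrite -[X in _ <= X](_ : u \vmax v = v) ?vleUl//.
  by apply: lattice_iso_inj; rewrite TU vjoin_r.
by rewrite -(vjoin_r h) TU vleUl.
Qed.

Lemma lattice_isoD u v : T (u + v) = T u + T v.
Proof. by have [TL _ _ _] := iT; rewrite -[u]scale1r TL !scale1r. Qed.

Lemma lattice_isoB u v : T (u - v) = T u - T v.
Proof.
by have [TL _ _ _] := iT; rewrite addrC -scaleN1r TL scaleN1r addrC.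
Qed.

Lemma lattice_iso0 : T 0 = 0.
Proof. by have := lattice_isoB 0 0; rewrite !subrr. Qed.

Lemma lattice_iso_ge0 u : (0 <= T u) = (0 <= u).
Proof. by rewrite -lattice_iso0 lattice_iso_le. Qed.

End LatticeIsomorphism.

(** * Lattices isomorphic to an order dual satisfy Nakano's criterion *)

Section OrderDualPerfect.
Context {R : realType} {V E : vectorLatticeType R}.
Variable T : V -> order_dual E.
Hypothesis iT : lattice_isomorphism T.

Lemma od_point_subproof (x : E) (x0 : 0 <= x) :
  (fun u => T u x : R^o) \in order_dual_pred V.
Proof.
have [TL _ _ _] := iT.
apply/order_dual_predP; split=> [a u v|a b]; first by rewrite TL.
exists (`|T a x| + `|T b x|) => u au ub.
have h1 : T a x <= T u x by apply: (elimT (od_leP _ _)) x0; rewrite (lattice_iso_le iT).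
have h2 : T u x <= T b x by apply: (elimT (od_leP _ _)) x0; rewrite (lattice_iso_le iT).
rewrite ler_norml (le_trans _ h1)/= ?(le_trans h2)//.
  by rewrite (le_trans (ler_norm _))// lerDr.
by rewrite lerNl (le_trans (ler_norm _))// normrN lerDl.
Qed.

Definition od_point (x : E) (x0 : 0 <= x) : order_dual V :=
  OrderDual (od_point_subproof x0).

Lemma od_point_ge0 x (x0 : 0 <= x) : 0 <= od_point x0.
Proof. by apply/od_ge0P => u; rewrite -(lattice_iso_ge0 iT) => /od_ge0P /(_ x x0). Qed.

(** The elements [T (a0 - a)] have a pointwise supremum in the order dual, which by surjectivity is
    some [T t]. Since [A] has infimum [0], [a0 <= t], so the values [T a x] become small. *)
Lemma od_point_oc x (x0 : 0 <= x) : order_continuous (od_point x0).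
Proof.
apply/order_continuousP => A dA A0 e e0.
have [[a0 Aa0] dir] := dA.
pose D := [set T (a0 - a) | a in [set a | A a /\ a <= a0]].
have [|||s [sD sadh _]] := @od_directed_sup R E D.
- split; first by exists (T (a0 - a0)), a0.
  move=> _ _ [a [Aa aa0] <-] [b [Ab ba0] <-].
  have [c [Ac ca cb]] := dir _ _ Aa Ab.
  exists (T (a0 - c)); rewrite !(lattice_iso_le iT) !vleD2l !vleN2; split => //.
  by exists c => //; split => //; exact: le_trans ca aa0.
- by move=> _ [a [Aa aa0] <-]; rewrite (lattice_iso_ge0 iT) vsub_ge0.
- move=> u u0; exists (T a0 u) => _ [a [Aa aa0] <-].
  apply: (elimT (od_leP _ _)) u0.
  by rewrite (lattice_iso_le iT) vleBlDr -[X in X <= _]addr0 vleD2l (infimums_ge0 A0 Aa).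
have [t ts] := lattice_iso_onto iT s.
have ta0 : a0 <= t.
  rewrite -vsub_ge0 -vleN2 oppr0 opprB.
  apply: A0.2 => a Aa; have [c [Ac ca cb]] := dir _ _ Aa Aa0.
  rewrite vleBlDr; apply: (@le_trans _ _ (c + t)); last by rewrite vleD2r.
  rewrite addrC -vleBlDr -(lattice_iso_le iT) ts; apply: sD.1; exists c => //.
have [_ [a [Aa aa0] <-]] := sadh x e x0 e0.
have h : T a0 x <= s x by apply: (elimT (od_leP _ _)) x0; rewrite -ts (lattice_iso_le iT).
rewrite (lattice_isoB iT) => h'; exists a => //.
have h'' : s x - e < T a0 x - T a x by exact: h'.
rewrite ger0_norm; last by apply: od_ge0 (od_point_ge0 x0) (infimums_ge0 A0 Aa).
by rewrite -[od_point x0 a]/(T a x); lra.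
Qed.

Lemma order_dual_separating : separating V.
Proof.
move=> u u0 un0; apply: contrapT => h; apply: un0; apply: (lattice_iso_inj iT); rewrite (lattice_iso0 iT).
apply: od_ext => x x0; apply: contrapT => h'; apply: h.
by exists (od_point x0); split; [exact: od_point_ge0|exact: od_point_oc|].
Qed.

Lemma order_dual_levi : levi V.
Proof.
move=> D [[u0 Du0] dir] D0 Db.
have [|||s [sD _ _]] := @od_directed_sup R E [set T u | u in D].
- split; first by exists (T u0), u0.
  move=> _ _ [u Du <-] [v Dv <-]; have [w [Dw uw vw]] := dir _ _ Du Dv.
  by exists (T w); rewrite !(lattice_iso_le iT); split => //; exists w.
- by move=> _ [u Du <-]; rewrite (lattice_iso_ge0 iT); exact: D0.
- move=> x x0; have [M hM] := Db _ (od_point_ge0 x0) (od_point_oc x0).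
  by exists M => _ [u Du <-]; exact: hM.
have [t ts] := lattice_iso_onto iT s; exists t; split.
  by move=> u Du; rewrite -(lattice_iso_le iT) ts; apply: sD.1; exists u.
move=> v vD; rewrite -(lattice_iso_le iT) ts; apply: sD.2 => _ [u Du <-].
by rewrite (lattice_iso_le iT); exact: vD.
Qed.

End OrderDualPerfect.

(** * Truncation units and domination of series of functionals *)

(** Abstracts the role of the constant [1]: each positive functional sees each positive vector as
    bounded by a multiple of [e]. *)
Definition trunc_unit (R : realType) (V : vectorLatticeType R) (e : V) : Prop :=
  0 <= e /\ forall (f : order_dual V) u, 0 <= f -> 0 <= u ->
    exists n : nat, f (vpos (u - n%:R *: e)) = 0.

Section TruncUnit.
Context {R : realType} {V : vectorLatticeType R} (e : V).
Hypothesis eV : trunc_unit e.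
Implicit Types (f g : order_dual V) (u v w : V).

Lemma le_vposB u v : u <= v + vpos (u - v).
Proof. by rewrite addrC -vleBlDr vleUl. Qed.

(** If [f] does not see [v] above [m e], then neither does any [nu n], so [nu n v <= m 2^-n] with
    one [m] for all [n]; the partial sums are bounded pointwise and [mu] is their supremum. *)
Lemma trunc_unit_series f (nu : nat -> order_dual V) : 0 <= f ->
  (forall n, 0 <= nu n) -> (forall n, order_continuous (nu n)) ->
  (forall n v, 0 <= v -> f v = 0 -> nu n v = 0) ->
  (forall n, nu n e <= 2^-1 ^+ n) ->
  exists2 mu, order_continuous mu & forall n, nu n <= mu.
Proof.
move=> f0 nu0 cnu fnu nue.
pose S N := \sum_(n < N) nu n.
have SS N : S N.+1 = S N + nu N by rewrite /S big_ord_recr.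
have S0 N : 0 <= S N.
  elim: N => [|N IH]; first by rewrite /S big_ord0.
  by rewrite SS vaddr_ge0.
have SmonoS N : S N <= S N.+1.
  by rewrite SS -[X in X <= _]addr0 vleD2l.
have Smono N M : (N <= M)%N -> S N <= S M.
  move=> /subnK <-; elim: (M - N)%N => [//|k IH].
  by rewrite addSn (le_trans IH).
have cS N : order_continuous (S N).
  apply/oc_predP; elim: N => [|N IH]; first by rewrite /S big_ord0 oc_pred0.
  by rewrite SS oc_predD//; apply/oc_predP.
have [|||mu [muS _ cmu]] := @od_directed_sup R V (range S).
- split; first by exists (S 0%N), 0%N.
  move=> _ _ [m _ <-] [k _ <-]; exists (S (maxn m k)).
  by split; [exists (maxn m k)| |]; rewrite ?Smono ?leq_maxl ?leq_maxr.
- by move=> _ [N _ <-].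
- move=> v v0; have [m fm] := eV.2 f v f0 v0.
  have le n : nu n v <= m%:R * 2^-1 ^+ n.
    apply: le_trans (od_mono (nu0 n) (le_vposB v (m%:R *: e))) _.
    by rewrite odD odZ (fnu n (vpos _)) ?vpos_ge0// addr0 ler_wpM2l.
  exists (m%:R * 2) => _ [N _ <-].
  suff h : S N v <= m%:R * (2 - 2 * 2^-1 ^+ N).
    apply: le_trans h _; rewrite ler_wpM2l// gerBl mulr_ge0// exprn_ge0//.
  elim: N => [|N IH].
    by rewrite /S big_ord0 od_zeroE expr0 mulr1 subrr mulr0.
  rewrite SS od_addE; apply: le_trans (lerD IH (le N)) _.
  by rewrite exprS mulrA divff ?pnatr_eq0// mul1r -mulrDr; apply: ler_wpM2l => //; lra.
exists mu; first by apply: cmu => _ [N _ <-].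
move=> n; apply: (@le_trans _ _ (S n.+1)); last by apply: muS.1; exists n.+1.
by rewrite SS -[X in X <= _]add0r vleD2r.
Qed.

(** Choose [f n] in [A] with value below [4^-n] at [e]. The functionals [2^n f n] are still summable
    at [e], so a single [m] dominates them, and [M (f n) <= 2^-n M m]. *)
Lemma trunc_unit_oc (L : order_dual (oc_dual V)) : order_continuous L.
Proof.
suff pos (M : order_dual (oc_dual V)) : 0 <= M -> order_continuous M.
  apply/oc_predP; rewrite -[L]vposBneg oc_predD//; first exact/oc_predP/pos/vpos_ge0.
  exact/oc_predP/ocN/pos/vneg_ge0.
move=> M0; apply/order_continuousP => A dA A0 d d0.
have [[f0 Af0] dir] := dA.
have fge (p : oc_dual V) : A p -> 0 <= p by move=> Ap; exact: A0.1 Ap.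
have hn n : exists f : oc_dual V, [/\ A f, f <= f0 & oc_eval e f < 4^-1 ^+ n].
  have h4 : 0 < (4^-1 : R) ^+ n by rewrite exprn_gt0// invr_gt0.
  have [g Ag ge] := oc_inf_eval dA A0 eV.1 h4.
  have [h [Ah hg hf0]] := dir _ _ Ag Af0; exists h; split => //.
  by apply: le_lt_trans ge; move/oc_leP : hg; apply; exact: eV.1.
have {hn} [f hf] := choice hn.
have f00 : 0 <= (val f0 : order_dual V) by exact: fge.
have [||||mu cmu numu] := @trunc_unit_series (val f0) (fun n => (2 ^+ n : R) *: val (f n)) f00.
- move=> n; have [Af _ _] := hf n; apply: vl_scale_ge0; first by rewrite exprn_ge0.
  exact: (fge _ Af).
- move=> n; have : (2 ^+ n : R) *: val (f n) \in sl_pred (oc_sublattice V).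
    exact: (valP ((2 ^+ n : R) *: f n)).
  by move/oc_predP.
- move=> n v v0 fv; have [Af /oc_leP fle _] := hf n.
  rewrite od_scaleE; suff -> : (val (f n) : order_dual V) v = 0 by rewrite mulr0.
  apply/eqP; rewrite eq_le; apply/andP; split; first by rewrite -fv; exact: fle.
  by apply: od_ge0 v0; exact: (fge _ Af).
- move=> n; have [_ _ /ltW fe] := hf n; rewrite od_scaleE.
  rewrite -[_ e]/(oc_eval e (f n)).
  have -> : (2^-1 : R) ^+ n = 2 ^+ n * 4^-1 ^+ n.
    by rewrite -exprMn; congr (_ ^+ _); lra.
  by rewrite ler_wpM2l// exprn_ge0.
have muP : mu \in sl_pred (oc_sublattice V) by exact/oc_predP.
pose m : oc_dual V := SubOf _ muP.
have m0 : 0 <= m.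
  have [Af _ _] := hf 0%N; apply: (@le_trans _ _ ((2 ^+ 0 : R) *: f 0%N)).
    by rewrite expr0 scale1r fge.
  exact: (numu 0%N).
have Mm0 : 0 < d / (M m + 1) by rewrite divr_gt0// ltr_wpDl// od_ge0.
have [n hn] := half_expr_lt Mm0; have [Af _ _] := hf n.
exists (f n) => //; rewrite ger0_norm ?od_ge0 ?fge//.
have h : (2 ^+ n : R) *: f n <= m by exact: (numu n).
have := od_mono M0 h; rewrite odZ => h'.
have p2 : 0 < (2 : R) ^+ n by rewrite exprn_gt0.
rewrite -(ltr_pM2l p2); apply: le_lt_trans h' _.
have Mm1 : 0 < M m + 1 by rewrite ltr_wpDl// od_ge0.
move: hn; rewrite ltr_pdivlMr// exprVn ltr_pdivrMl//; lra.
Qed.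

(** Gliding hump: otherwise [f] sees some [u n] of [D] above [4^n e]. The part [g n] of [f] living
    there, scaled to value [2^-n] at [e], is at least [2^n] at [u n], and an order continuous [mu]
    dominating all of these is unbounded on [D]. *)
Lemma trunc_unit_bounded f (D : set V) : 0 <= f -> order_continuous f ->
  (forall u, D u -> 0 <= u) ->
  (forall g, 0 <= g -> order_continuous g ->
     exists M : R, forall u, D u -> g u <= M) ->
  exists M : R, forall u, D u -> f (vpos (u - M *: e)) = 0.
Proof.
move=> f0 cf D0 Db; apply: contrapT => hM.
have hn n : exists u, D u /\ f (vpos (u - (4 ^+ n : R) *: e)) <> 0.
  apply: contrapT => h; apply: hM; exists (4 ^+ n) => u Du.
  by apply: contrapT => h'; apply: h; exists u.
have {hM hn} [u hu] := choice hn.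
pose w n := vpos (u n - (4 ^+ n : R) *: e).
have [g hg] := choice (fun n => od_component f0 (vpos_ge0 (u n - (4 ^+ n : R) *: e))).
(* If [g n] vanished at [e], it would vanish at [w n <= m e + vpos (w n - m e)] for a suitable [m],
   though [g n (w n) = f (w n)] is nonzero. *)
have ge0 n : 0 < g n e.
  have [g0 gf gw _] := hg n; have [m gm] := eV.2 _ _ g0 (vpos_ge0 (u n - (4 ^+ n : R) *: e)).
  have wn0 : 0 < g n (w n).
    rewrite lt_neqAle od_ge0 ?vpos_ge0// andbT eq_sym; apply/eqP.
    by rewrite gw; exact: (hu n).2.
  have := od_mono g0 (le_vposB (w n) (m%:R *: e)).
  rewrite odD gm addr0 odZ => h; rewrite ltNge; apply/negP => ge.
  by have := mulr_ge0_le0 (ler0n R m) ge; lra.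
pose nu n := (2^-1 ^+ n / g n e) *: g n.
have c0 n : 0 <= (2^-1 : R) ^+ n / g n e.
  by rewrite divr_ge0 ?exprn_ge0 ?invr_ge0// ltW.
have cg n : g n \in sl_pred (oc_sublattice V).
  have [g0 gf _ _] := hg n; apply: (@oc_pred_solid _ _ f); first exact/oc_predP.
  by rewrite !vabs_id.
have [|n|n v v0 fv|n|mu cmu numu] := @trunc_unit_series f nu f0.
- by move=> n; apply: vl_scale_ge0 => //; have [] := hg n.
- apply/oc_predP; exact: (valP ((2^-1 ^+ n / g n e) *: SubOf _ (cg n))).
- have [g0 /od_leP gf _ _] := hg n; rewrite od_scaleE.
  suff -> : g n v = 0 by rewrite mulr0.
  by apply/eqP; rewrite eq_le od_ge0// -fv gf.
- by rewrite od_scaleE mulfVK// gt_eqF.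
have mu0 : 0 <= mu.
  by apply: le_trans (numu 0%N); apply: vl_scale_ge0 => //; have [] := hg 0%N.
have [M hM] := Db mu mu0 cmu.
have [n hn] : exists n : nat, M < n%:R.
  by exists (Num.bound `|M|); apply: le_lt_trans (ler_norm _) _; exact: archi_boundP.
have Mn : 2 ^+ n <= M.
  apply: le_trans (hM _ (hu n).1).
  have un0 : g n (u n) = 4 ^+ n * g n e + g n (w n).
    have [g0 _ _ gd] := hg n.
    have := vposBneg (u n - (4 ^+ n : R) *: e).
    move=> /(congr1 (g n)); rewrite !odB odZ (gd (vneg _)) ?vneg_ge0//; last first.
      by rewrite vmeetC; exact: vpos_meet_vneg.
    by rewrite -/(w n); lra.
  have unD : 0 <= u n by exact: D0 (hu n).1.
  apply: (@le_trans _ _ (nu n (u n))); last by move/od_leP : (numu n); apply.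
  have -> : (2 : R) ^+ n = 2^-1 ^+ n / g n e * (4 ^+ n * g n e).
    rewrite mulrACA [X in _ = _ * X]mulrC mulfV ?gt_eqF// mulr1 -exprMn.
    by congr (_ ^+ _); lra.
  rewrite od_scaleE ler_wpM2l// un0 lerDl od_ge0 ?vpos_ge0//.
  by have [] := hg n.
have : (n%:R : R) < 2 ^+ n by rewrite -natrX ltr_nat ltn_expl.
lra.
Qed.

End TruncUnit.

(** * Continuous functions: the constant 1 and Dedekind completeness *)

Section ContFun.
Context (R : realType) (X : topologicalType).
Local Notation V := (cont_fun R X).
Implicit Types u v : V.

Lemma cont_continuous u : continuous (u : X -> R).
Proof. exact: cts_fun. Qed.

Lemma cont_lt u x (r : R) : u x < r -> \forall y \near x, u y < r.
Proof. by move=> ur; apply: (cvgr_lt (u x)) => //; exact: cont_continuous. Qed.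

Lemma cont_gt u x (r : R) : r < u x -> \forall y \near x, r < u y.
Proof. by move=> ur; apply: (cvgr_gt (u x)) => //; exact: cont_continuous. Qed.

Definition cont_cst (c : R) : V := mkcts (@cst_continuous X R c).

Lemma cont_vposE u (n : nat) x :
  vpos (u - n%:R *: cont_cst 1) x = Num.max (u x - n%:R) 0.
Proof.
rewrite -[LHS]/(Num.max (u x - n%:R * 1) 0); by rewrite mulr1.
Qed.

(* If f were positive on every truncation, the locally finite series
   h = sum_n (u - n)^+ / f((u - n)^+) would satisfy f h >= N for all N. *)
Lemma cont_trunc_unit : trunc_unit (cont_cst 1).
Proof.
split; first by apply/cont_leP => x; exact: ler01.
move=> f u f0 u0; apply: contrapT => hn.
pose w n := vpos (u - n%:R *: cont_cst 1).
have fw n : 0 < f (w n).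
  rewrite lt_neqAle od_ge0 ?vpos_ge0// andbT eq_sym; apply/eqP => h.
  by apply: hn; exists n.
pose S N : V := \sum_(n < N) (f (w n))^-1 *: w n.
have SE N : S N.+1 = S N + (f (w N))^-1 *: w N by rewrite /S big_ord_recr.
have SSx N x : S N.+1 x = S N x + (f (w N))^-1 * w N x by rewrite SE.
have fS N : f (S N) = N%:R.
  elim: N => [|N IH]; first by rewrite /S big_ord0 od0.
  by rewrite SE odD odZ IH mulVf ?gt_eqF// -natr1.
have Smono N M : (N <= M)%N -> S N <= S M.
  move=> /subnK <-; elim: (M - N)%N => [//|k IH].
  rewrite addSn (le_trans IH)// SE -[X in X <= _]addr0 vleD2l.
  by rewrite vl_scale_ge0 ?invr_ge0 ?vpos_ge0// ltW.
have Sstable N M x : u x <= N%:R -> (N <= M)%N -> S M x = S N x.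
  move=> uN /subnK <-; elim: (M - N)%N => [//|k IH].
  rewrite addSn SSx IH cont_vposE.
  suff -> : Num.max (u x - (k + N)%:R) 0 = 0 by rewrite mulr0 addr0.
  apply/max_idPr; rewrite subr_le0 (le_trans uN)// ler_nat leq_addl//.
pose N x := Num.bound `|u x|.
have uN x : u x < (N x)%:R.
  by apply: le_lt_trans (ler_norm _) _; exact: archi_boundP.
(* The sum of the series: near [x] the values of [u] stay below [N x], so all terms from index [N x]
   on vanish there and [h] coincides with [S (N x)]. *)
pose h x := S (N x) x.
have hE M x : u x <= M%:R -> h x = S M x.
  move=> uM; rewrite /h.
  rewrite -(Sstable (N x) (maxn (N x) M) x) ?leq_maxl ?(ltW (uN x))//.
  by rewrite -(Sstable M (maxn (N x) M) x) ?leq_maxr.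
have ch : continuous h.
  move=> x; have near_eq : {near x, S (N x) =1 h}.
    have := cont_lt (uN x).
    by apply: filterS => y uy; rewrite (hE (N x))// ltW.
  rewrite /continuous_at -(nbhs_singleton near_eq).
  apply: (cvg_trans (near_eq_cvg near_eq)); exact: cont_continuous.
have hS M : S M <= (mkcts ch : V).
  apply/cont_leP => x; rewrite [X in _ <= X](_ : _ = h x)//.
  rewrite (hE (maxn (N x) M)); last first.
    by rewrite (le_trans (ltW (uN x)))// ler_nat leq_maxl.
  by have /cont_leP := Smono M (maxn (N x) M) (leq_maxr _ _); exact.
have [n hn'] : exists n : nat, f (mkcts ch : V) < n%:R.
  exists (Num.bound `|f (mkcts ch : V)|).
  by apply: le_lt_trans (ler_norm _) _; exact: archi_boundP.
by have := od_mono f0 (hS n); rewrite fS leNgt hn'.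
Qed.

Hypothesis hX : extremally_disconnected X.

(** The supremum is rebuilt from its level sets: the closures [U r] are clopen by extremal
    disconnectedness and decrease in [r], which makes [g x = sup {r | U r x}] continuous. *)
Lemma cont_dedekind : dedekind V.
Proof.
move=> D b [[f0 Df0] _] _ Db.
pose U (r : R) := closure [set x | exists2 f, D f & r < (f : V) x].
have oU r : open (U r).
  apply: hX; rewrite openE => x [f Df fx].
  have := cont_gt fx.
  by rewrite /interior; apply: filterS => y fy; exists f.
have cU r : open (~` U r) by apply: closed_openC; exact: closed_closure.
have Uanti r s x : r <= s -> U s x -> U r x.
  by move=> rs; apply: closure_subset => y [f Df fy]; exists f => //; exact: le_lt_trans fy.
have Ub r x : U r x -> r <= b x.
  move=> Ux; rewrite leNgt; apply/negP => bx.
  have [y [[f Df fy] by_]] := Ux _ (cont_lt bx).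
  have /cont_leP/(_ y) := Db f Df; rewrite /= in by_ *; lra.
pose g x := sup [set r | U r x].
have fU f r x : D f -> r < (f : V) x -> U r x.
  by move=> Df rf; apply: subset_closure; exists f.
have hs x : has_sup [set r | U r x].
  split; last by exists (b x) => r; exact: Ub.
  by exists ((f0 : V) x - 1); apply: (fU f0) => //; lra.
have Ug r x : U r x -> r <= g x.
  by move=> Ux; apply: ub_le_sup => //; exact: (hs x).2.
have gU r x : r < g x -> U r x.
  move=> rg; have e0 : 0 < g x - r by lra.
  have [s Us sg] := sup_adherent e0 (hs x).
  by apply: Uanti Us; rewrite -/(g x) in sg; lra.
have cg : continuous g.
  move=> x; apply/cvgrPdist_lt => e e0.
  have h1 : nbhs x (U (g x - e / 2)).
    by apply: open_nbhs_nbhs; split => //; apply: gU; lra.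
  have h2 : nbhs x (~` U (g x + e / 2)).
    by apply: open_nbhs_nbhs; split => // /Ug; lra.
  apply: filterS2 h1 h2 => y /Ug y1 y2.
  have y3 : g y <= g x + e / 2.
    by rewrite leNgt; apply/negP => /gU.
  by rewrite ltr_norml; lra.
exists (mkcts cg : V); split.
  move=> f Df; apply/cont_leP => x; rewrite [X in _ <= X](_ : _ = g x)//.
  rewrite leNgt; apply/negP => gf.
  have : U ((g x + (f : V) x) / 2) x by apply: fU Df _; lra.
  by move=> /Ug; lra.
move=> v vD; apply/cont_leP => x; rewrite [X in X <= _](_ : _ = g x)//.
apply: ge_sup; first exact: (hs x).1.
(* If [v x < r], then [v < r] near [x], a neighborhood that meets the set where some [f] in [D]
   exceeds [r]. *)
move=> r Ux; rewrite leNgt; apply/negP => vx.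
have [y [[f Df fy] vy]] := Ux _ (cont_lt vx).
have /cont_leP/(_ y) := vD f Df; rewrite /= in vy *; lra.
Qed.

End ContFun.

(** * Carrier projections and the product decomposition *)

Lemma band_proj_null (R : realType) (V : vectorLatticeType R)
    (f : order_dual V) (u : V) :
  0 <= f -> f (vabs u) = 0 -> band_proj (carrier f) u = 0.
Proof.
move=> f0 fu; rewrite /band_proj; case: xgetP => // v _ hv.
apply: val_inj => /=.
have nu : null_ideal f u by change (vabs f (vabs u) = 0); rewrite (vabs_id f0).
have /carrier_predP/(_ u nu) d2 := valP v.
have d1 := hv (val v) (valP v).
(* The projection [v] is disjoint from [u], which is null, and from [u - v]; hence it is disjoint
   from itself. *)
have v0 : vabs (val v) <= 0.
  rewrite -[X in X <= _](vmeet_r (lexx (vabs (val v)))).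
  apply: (@le_trans _ _ ((vabs (u - val v) + vabs u) \vmin vabs (val v))).
    apply: vmeetS => //; rewrite -[X in vabs X <= _](_ : - (u - val v) + u = _).
      by rewrite (le_trans (vabsD _ _))// vabsN.
    by rewrite opprB subrK.
  apply: le_trans (vmeetD_le _ _ _) _; rewrite ?vabs_ge0//.
  by rewrite d1 add0r vmeetC d2.
apply/eqP; rewrite eq_le (le_trans (vabs_ge _) v0)/=.
by rewrite -vleN2 oppr0 (le_trans (vabs_geN _) v0).
Qed.

Section CarrierDecomposition.
Context {R : realType} {V : vectorLatticeType R} (e : V).
Variable F : set (order_dual V).
Hypotheses (eV : trunc_unit e) (dV : dedekind V).
Hypotheses (F0 : forall f, F f -> 0 <= f) (Fc : F `<=` order_continuous (E := V)).

Definition carrier_map (u : V) :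
    vl_prod (fun phi : set_type F => sub_of (carrier (val phi))) :=
  fun phi => band_proj (carrier (val phi)) u.

Hypothesis iF : lattice_isomorphism carrier_map.

Let F_ge0 (phi : set_type F) : 0 <= val phi.
Proof. exact/F0/set_mem/valP. Qed.

Let F_oc (phi : set_type F) : order_continuous (val phi).
Proof. exact/Fc/set_mem/valP. Qed.

Lemma carrier_map_separating : separating V.
Proof.
move=> u u0 un0; apply: contrapT => h; apply: un0.
apply: (lattice_iso_inj iF); rewrite (lattice_iso0 iF).
apply: vl_prod_ext => phi; apply: band_proj_null => //; rewrite vabs_id//.
by apply: contrapT => h'; apply: h; exists (val phi).
Qed.

(** Surjectivity glues the components of [M phi *: e] into one vector [w]. Additivity and
    monotonicity of the projections are read off from the isomorphism, and the excess of [u] over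
    [M phi *: e] projects to [0]. *)
Lemma carrier_map_levi : levi V.
Proof.
move=> D uD D0 Db.
have hM (phi : set_type F) : exists M : R, forall u, D u ->
    val phi (vpos (u - M *: e)) = 0.
  by apply: (trunc_unit_bounded eV) => //; exact: F_ge0.
have [M {}hM] := choice hM.
have [w wE] := lattice_iso_onto iF (fun phi => band_proj (carrier (val phi)) (M phi *: e)).
apply: (dV (b := w)) => // u Du; rewrite -(lattice_iso_le iF) wE.
apply/prod_leP => phi.
have := le_vposB u (M phi *: e); rewrite -(lattice_iso_le iF) => /prod_leP/(_ phi).
rewrite (lattice_isoD iF) => h; apply: le_trans h _.
rewrite -[X in X <= _]/(carrier_map (M phi *: e) phi + carrier_map (vpos (u - M phi *: e)) phi).
by rewrite {2}/carrier_map band_proj_null ?addr0// vabs_id ?vpos_ge0// hM.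
Qed.

End CarrierDecomposition.

Theorem proposition6p19 (R : realType) (X : topologicalType)
  (hX : extremally_disconnected X) (hR : realcompact R X)
  (F : set (order_dual (cont_fun R X)))
  (hF : maximal_singular_oc_family F) :
  (lattice_isomorphism
     (fun u : cont_fun R X =>
        (fun phi : set_type F => band_proj (carrier (val phi)) u)
          : vl_prod (fun phi : set_type F => sub_of (carrier (val phi)))) ->
   perfect (cont_fun R X))
  /\
  (perfect (cont_fun R X) <->
   exists (E : vectorLatticeType R) (T : cont_fun R X -> order_dual E),
     lattice_isomorphism T).
Proof.
have [[F0 _] Fc _] := hF.
split=> [iF|].
  apply: nakano_perfect; first exact: (carrier_map_separating F0 Fc iF).
  exact: (carrier_map_levi (cont_trunc_unit R X) (cont_dedekind hX) F0 Fc iF).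
split=> [[Tlin TU TI [g gK Kg]]|[E [T iT]]]; last first.
  by apply: nakano_perfect; [exact: order_dual_separating iT|exact: order_dual_levi iT].
exists (oc_dual (cont_fun R X)), (@evaluation R (cont_fun R X)); split.
- move=> a u v; exact: (congr1 val (Tlin a u v)).
- move=> u v; exact: (congr1 val (TU u v)).
- move=> u v; exact: (congr1 val (TI u v)).
(* The order dual of [oc_dual] has only order continuous members, so the inverse [g] of [bidual_map]
   is defined on all of it. *)
have ocP (L : order_dual (oc_dual (cont_fun R X))) : L \in sl_pred (oc_sublattice (oc_dual (cont_fun R X))).
  by apply/oc_predP; exact: (trunc_unit_oc (cont_trunc_unit R X)).
exists (fun L => g (SubOf _ (ocP L))) => [u|L].
  by rewrite -[RHS]gK; congr g; exact: val_inj.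
exact: (congr1 val (Kg (SubOf _ (ocP L)))).
Qed.
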